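(* Suppose the losses $\ell_t$ satisfy Assumptions B1–B2 and let $\gamma:=2GB\sqrt{\alpha d/2}+1/\sqrt{2\alpha}$. Let $x_t$ be the predictions of FLH-ONS. Then $$R_n(C_n)\le\sup_{\substack{w_1,\dots,w_n\in\mathcal D\\ \sum_{t=2}^n\|w_t-w_{t-1}\|_1\le C_n}}\sum_{t=1}^nf_t(x_t)-f_t(w_t)$$ and this is $$\tilde O\Big(140\,d^2\big(8G^2B^2\alpha d+G^2B^2+1/\alpha\big)\big(n^{1/3}C_n^{2/3}\vee1\big)\Big)\mathbb I\{C_n>1/n\}+\tilde O\Big(d\big(8G^2B^2\alpha d+1/\alpha\big)\Big)\mathbb I\{C_n\le1/n\},$$ where $\tilde O$ hides polynomial factors of $\log n$, and $\mathbb I\{\cdot\}$ is the $\{0,1\}$-valued indicator.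
   Context: $\mathcal D=\{x\in\mathbb R^d:\|x\|_\infty\le B\}$. At each $t\in[n]$ the learner predicts $x_t\in\mathcal D$ and then the adversary reveals a differentiable convex loss $\ell_t$. Assumption B1: for all $x,y\in\mathcal D$, $\ell_t(y)\ge\ell_t(x)+\nabla\ell_t(x)^T(y-x)+\frac\alpha2(\nabla\ell_t(x)^T(y-x))^2$, with $\alpha>0$. Assumption B2: $\|\nabla\ell_t(x)\|_2\le G$ and $\|\nabla\ell_t(x)\|_\infty\le G_\infty$ for all $x\in\mathcal D$, and $\min\{G,G_\infty,B\}\ge1$. Surrogate losses: $f_t(x)=\big(\sqrt{\alpha/2}\,\nabla\ell_t(x_t)^T(x-x_t)+1/\sqrt{2\alpha}\big)^2$. $R_n(C_n)=\sup\{\sum_{t=1}^n\ell_t(x_t)-\ell_t(w_t): w_t\in\mathcal D,\ \sum_{t=2}^n\|w_t-w_{t-1}\|_1\le C_n\}$. ONS with parameter $\beta$ on losses $h_1,h_2,\dots$ over $\mathcal D$: let $D_0=2B\sqrt d$, $\epsilon=1/(\beta^2D_0^2)$, $A_0=\epsilon I$, $z_1\in\mathcal D$ fixed; for $\tau\ge1$, $A_\tau=A_{\tau-1}+\nabla h_\tau(z_\tau)\nabla h_\tau(z_\tau)^T$, $w=z_\tau-\beta^{-1}A_\tau^{-1}\nabla h_\tau(z_\tau)$, $z_{\tau+1}=\arg\min_{z\in\mathcal D}(w-z)^TA_\tau(w-z)$. FLH-ONS: for each $j\in[n]$ a base learner $E^j$ started at time $j$ runs ONS with parameter $\zeta=\min\{\frac1{16GB\sqrt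 d},\frac1{4\gamma^2}\}$ on the losses $f_t$, $t\ge j$, producing $x^{(j)}_t$; the FLH meta-algorithm with learning rate $\eta=1/(2\gamma^2)$ keeps $v_t=(v^{(1)}_t,\dots,v^{(t)}_t)$, $v_1=(1)$, predicts $x_t=\sum_{j\le t}v^{(j)}_tx^{(j)}_t$, and after $f_t$ is formed sets $\hat v^{(i)}_{t+1}=v^{(i)}_te^{-\eta f_t(x^{(i)}_t)}/\sum_{j\le t}v^{(j)}_te^{-\eta f_t(x^{(j)}_t)}$ for $i\le t$, $v^{(t+1)}_{t+1}=1/(t+1)$, $v^{(i)}_{t+1}=(1-\frac1{t+1})\hat v^{(i)}_{t+1}$. $a\vee b=\max\{a,b\}$. *)

(* Defs.v *)
From HB Require Import structures.
From mathcomp Require Import all_boot all_order all_algebra.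
From mathcomp Require Import all_classical all_reals all_analysis.
Set Implicit Arguments.
Unset Strict Implicit.
Unset Printing Implicit Defensive.
Import Order.TTheory GRing.Theory Num.Theory numFieldNormedType.Exports.
Local Open Scope classical_set_scope.
Local Open Scope ring_scope.

(* Vectors of R^d are row vectors 'rV[R]_d; indices t of rounds are 1-based nats. *)
Section FLH_ONS.
Variable R : realType.
Variable d : nat.
Local Notation vec := 'rV[R]_d.

Definition dotp (u v : vec) : R := \sum_(i < d) u 0 i * v 0 i.
Definition norm2 (u : vec) : R := Num.sqrt (\sum_(i < d) u 0 i ^+ 2).
Definition norm1 (u : vec) : R := \sum_(i < d) `|u 0 i|.
Definition normInf (u : vec) : R := \big[Num.max/0]_(i < d) `|u 0 i|.

Definition inD (B : R) (x : vec) : Prop := normInf x <= B.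

(* gradient of f : R^d -> R at x (i-th coordinate = differential of f at x
   applied to the i-th basis vector); meaningful where f is differentiable *)
Definition grad (f : vec -> R) (x : vec) : vec :=
  \row_(i < d) ('d f x (delta_mx 0 i : vec)).

Definition convex_on_D (B : R) (f : vec -> R) : Prop :=
  forall x y (lam : R), inD B x -> inD B y -> 0 <= lam <= 1 ->
    f (lam *: x + (1 - lam) *: y) <= lam * f x + (1 - lam) * f y.

Definition assumptionB1 (B alpha : R) (f : vec -> R) : Prop :=
  forall x y, inD B x -> inD B y ->
    f x + dotp (grad f x) (y - x) + alpha / 2 * (dotp (grad f x) (y - x)) ^+ 2
      <= f y.

Definition assumptionB2 (B G Ginf : R) (f : vec -> R) : Prop :=
  forall x, inD B x -> norm2 (grad f x) <= G /\ normInf (grad f x) <= Ginf.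

(* surrogate loss f_t built from g = grad l_t(x_t) and xt = x_t *)
Definition surrogate (alpha : R) (g xt : vec) (x : vec) : R :=
  (Num.sqrt (alpha / 2) * dotp g (x - xt) + 1 / Num.sqrt (2 * alpha)) ^+ 2.

Definition gammaP (B G alpha : R) : R :=
  2 * G * B * Num.sqrt (alpha * d%:R / 2) + 1 / Num.sqrt (2 * alpha).
Definition zetaP (B G alpha : R) : R :=
  Num.min (1 / (16 * G * B * Num.sqrt d%:R)) (1 / (4 * gammaP B G alpha ^+ 2)).
Definition etaP (B G alpha : R) : R := 1 / (2 * gammaP B G alpha ^+ 2).
Definition D0 (B : R) : R := 2 * B * Num.sqrt d%:R.
Definition epsP (B beta : R) : R := 1 / (beta ^+ 2 * D0 B ^+ 2).

(* generalized projection: argmin_{z in D} (w - z)^T A (w - z)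
   (the minimizer exists and is unique for A positive definite) *)
Definition quadf (A : 'M[R]_d) (u : vec) : R := (u *m A *m u^T) 0 0.
Definition projA (B : R) (A : 'M[R]_d) (w : vec) : vec :=
  xget w [set z | inD B z /\ forall y, inD B y -> quadf A (w - z) <= quadf A (w - y)].

(* one ONS update from (A_{tau-1}, z_tau) with g = grad h_tau(z_tau) *)
Definition ons_A (A : 'M[R]_d) (g : vec) : 'M[R]_d := A + g^T *m g.
Definition ons_z (B beta : R) (A : 'M[R]_d) (z g : vec) : vec :=
  let A' := ons_A A g in
  let w := z - beta^-1 *: (invmx A' *m g^T)^T in
  projA B A' w.

(* state of FLH-ONS at the beginning of a round t:
   st_z j = x^{(j)}_t (current iterate of base learner E^j; for j > t it is
   still its initial point), st_A j = current ONS matrix of E^j,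
   st_v j = v^{(j)}_t *)
Record flh_state := FlhState {
  st_z : nat -> vec;
  st_A : nat -> 'M[R]_d;
  st_v : nat -> R }.

Variables (B G alpha : R) (loss : nat -> vec -> R) (init : nat -> vec).

Definition flh_pred (S : flh_state) (t : nat) : vec :=
  \sum_(1 <= j < t.+1) st_v S j *: st_z S j.

Definition flh_surr (S : flh_state) (t : nat) : vec -> R :=
  let xt := flh_pred S t in surrogate alpha (grad (loss t) xt) xt.

Definition flh_step (S : flh_state) (t : nat) : flh_state :=
  let f := flh_surr S t in
  let eta := etaP B G alpha in
  let zeta := zetaP B G alpha in
  let Z := \sum_(1 <= j < t.+1) st_v S j * expR (- eta * f (st_z S j)) in
  FlhState
    (fun j => if (1 <= j <= t)%N
              then ons_z B zeta (st_A S j) (st_z S j) (grad f (st_z S j))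
              else st_z S j)
    (fun j => if (1 <= j <= t)%N
              then ons_A (st_A S j) (grad f (st_z S j))
              else st_A S j)
    (fun j => if (1 <= j <= t)%N
              then (1 - (t.+1)%:R^-1) * (st_v S j * expR (- eta * f (st_z S j)) / Z)
              else if j == t.+1 then (t.+1)%:R^-1 else 0).

Definition flh_init : flh_state :=
  FlhState init (fun _ => (epsP B (zetaP B G alpha))%:M)
    (fun j => if j == 1%N then 1 else 0).

(* flh_run k = state at the beginning of round k+1 *)
Fixpoint flh_run (k : nat) : flh_state :=
  match k with
  | 0 => flh_init
  | k'.+1 => flh_step (flh_run k') k'.+1
  end.

Definition flh_x (t : nat) : vec := flh_pred (flh_run t.-1) t.

Definition flh_f (t : nat) : vec -> R :=
  surrogate alpha (grad (loss t) (flh_x t)) (flh_x t).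

End FLH_ONS.

Definition feasible (R : realType) (d : nat) (B : R) (n : nat) (C : R) :
    set (nat -> 'rV[R]_d) :=
  [set w | (forall t, (1 <= t <= n)%N -> inD B (w t)) /\
           \sum_(2 <= t < n.+1) norm1 (w t - w t.-1) <= C].

Definition dyn_regret (R : realType) (d : nat) (B : R) (n : nat) (C : R)
    (h : nat -> 'rV[R]_d -> R) (x : nat -> 'rV[R]_d) : \bar R :=
  ereal_sup [set (\sum_(1 <= t < n.+1) (h t (x t) - h t (w t)))%:E
            | w in feasible B n C].

Definition indicb (R : realType) (b : bool) : R := if b then 1 else 0.

(* Main.v *)
Require Import Defs.
From HB Require Import structures.
From mathcomp Require Import all_boot all_order all_algebra.
From mathcomp Require Import all_classical all_reals all_analysis.
From mathcomp Require Import perm ring lra zify.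
Import Order.TTheory GRing.Theory Num.Theory numFieldNormedType.Exports.
Local Open Scope classical_set_scope.
Local Open Scope ring_scope.

(** Since the surrogates are squares of affine functions, FLH with ONS experts has
    regret at most [S = O(d (G^2 B^2 alpha d + 1/alpha) log n)] against any fixed
    point on any interval of rounds.  Passing to moving comparators only uses this
    and the fact that the regret [Phi(w) = sum_t f_t(x_t) - f_t(w_t)] is a concave
    quadratic.  Let [w] maximize [Phi(w) - K TV(w)^(2/3)]; because [V^(2/3)] is
    concave, [w] also maximizes [Phi - lam TV], [lam] being the slope of the penalty
    at [TV(w)].  Track each coordinate of [w] lazily: [u] jumps to [w] only when [w]
    is [delta] away or touches the boundary of the box.  Each jump of [u] then has
    the direction of the jump of [w], so [w + e (w - u)] is feasible for small [e]
    and its variation is at most [(1 + e) TV(w)]; optimality of [w] gives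
    [Phi(w) <= Phi(u) + lam TV(w) + O(alpha G^2 n d delta^2)].  As [u] has
    [O(d + TV(w) / delta)] pieces, [Phi(u) <= O(d + TV(w) / delta) S].  Taking
    [delta^3 = TV(w) / (n d)], all terms in [TV(w)] are absorbed by the penalty, and
    [Phi <= (1 + d) S + K TV^(2/3)] for every comparator. *)

Set Implicit Arguments.
Unset Strict Implicit.
Unset Printing Implicit Defensive.

(** * Inner product, norms and the box in R^d *)

Section Vectors.
Context {R : realType} {d : nat}.
Implicit Types (u v w x : 'rV[R]_d) (B a : R).

Lemma inDP B x : 0 <= B -> inD B x <-> forall i, `|x 0 i| <= B.
Proof.
move=> B0; split => [xB i|xB]; last by rewrite /inD /normInf; apply: bigmax_le.
by apply: le_trans xB; exact: (le_bigmax_cond 0 (fun i => `|x 0 i|)).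
Qed.

Lemma dotpC u v : dotp u v = dotp v u.
Proof. by apply: eq_bigr => i _; rewrite mulrC. Qed.

Lemma dotpDr u v w : dotp u (v + w) = dotp u v + dotp u w.
Proof. by rewrite -big_split; apply: eq_bigr => i _; rewrite mxE mulrDr. Qed.

Lemma dotpZr u a v : dotp u (a *: v) = a * dotp u v.
Proof. by rewrite [RHS]mulr_sumr; apply: eq_bigr => i _; rewrite mxE; ring. Qed.

Lemma dotpNr u v : dotp u (- v) = - dotp u v.
Proof. by rewrite -scaleN1r dotpZr mulN1r. Qed.

Lemma dotpBr u v w : dotp u (v - w) = dotp u v - dotp u w.
Proof. by rewrite dotpDr dotpNr. Qed.

Lemma dotpZl u a v : dotp (a *: u) v = a * dotp u v.
Proof. by rewrite dotpC dotpZr dotpC. Qed.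

Lemma dotp0r u : dotp u 0 = 0.
Proof. by rewrite /dotp big1// => i _; rewrite mxE mulr0. Qed.

Lemma dotp_sumr I (r : seq I) (P : pred I) u (F : I -> 'rV[R]_d) :
  dotp u (\sum_(i <- r | P i) F i) = \sum_(i <- r | P i) dotp u (F i).
Proof.
by elim/big_rec2: _ => [|i y x _ <-]; rewrite ?dotp0r// dotpDr.
Qed.

Lemma dotp_delta u i : dotp u (delta_mx 0 i) = u 0 i.
Proof.
rewrite /dotp (bigD1 i)//= mxE !eqxx mulr1 big1 ?addr0// => j ji.
by rewrite mxE (negbTE ji) andbF mulr0.
Qed.

Lemma dotpp_ge0 u : 0 <= dotp u u.
Proof. by apply: sumr_ge0 => i _; rewrite -expr2 sqr_ge0. Qed.

Lemma dotpp_eq0 u : dotp u u = 0 -> u = 0.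
Proof.
move=> /eqP; rewrite psumr_eq0 => [/allP u0|i _]; last by rewrite -expr2 sqr_ge0.
apply/rowP => i; rewrite mxE; apply/eqP.
by have := u0 i (mem_index_enum _); rewrite -expr2 sqrf_eq0.
Qed.

Lemma sqr_norm2 u : norm2 u ^+ 2 = dotp u u.
Proof.
rewrite /norm2 sqr_sqrtr; first by apply: eq_bigr => i _; rewrite expr2.
by apply: sumr_ge0 => i _; rewrite sqr_ge0.
Qed.

Lemma norm2_ge0 u : 0 <= norm2 u. Proof. exact: sqrtr_ge0. Qed.

(** For nonzero v, the squared length of (v.v) u - (u.v) v is v.v times the difference of the two
    sides. *)
Lemma dotp_CauchySchwarz u v : dotp u v ^+ 2 <= dotp u u * dotp v v.
Proof.
have [v0|v0] := eqVneq (dotp v v) 0.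
  by rewrite (dotpp_eq0 v0) !dotp0r mulr0 expr0n.
have vp : 0 < dotp v v by rewrite lt_neqAle eq_sym v0 dotpp_ge0.
have := dotpp_ge0 (dotp v v *: u - dotp u v *: v).
rewrite dotpBr !dotpZr !(dotpC (_ - _)) !dotpBr !dotpZr (dotpC v u) => h.
rewrite -subr_ge0 -(pmulr_rge0 _ vp); apply: le_trans h _.
by apply/eqP/eqP; rewrite le_eqVlt; apply/orP; left; apply/eqP; ring.
Qed.

Lemma norm_dotp_le u v : `|dotp u v| <= norm2 u * norm2 v.
Proof.
rewrite -(@ler_pXn2r _ 2) ?nnegrE ?mulr_ge0 ?norm2_ge0//.
by rewrite real_normK ?num_real// exprMn !sqr_norm2 dotp_CauchySchwarz.
Qed.

Lemma norm2_le B x : 0 <= B -> (forall i, `|x 0 i| <= B) ->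
  norm2 x <= B * Num.sqrt d%:R.
Proof.
move=> B0 xB; rewrite -(@ler_pXn2r _ 2) ?nnegrE ?norm2_ge0 ?mulr_ge0 ?sqrtr_ge0//.
rewrite sqr_norm2 exprMn sqr_sqrtr ?ler0n// mulr_natr.
have -> : B ^+ 2 *+ d = \sum_(i < d) B ^+ 2 by rewrite sumr_const card_ord.
apply: ler_sum => i _; rewrite -expr2 -(real_normK (num_real (x 0 i))).
by rewrite ler_pXn2r ?nnegrE.
Qed.

Lemma norm2_sub_le B x y : 0 <= B -> inD B x -> inD B y ->
  norm2 (x - y) <= 2 * B * Num.sqrt d%:R.
Proof.
move=> B0 /(inDP _ B0) xB /(inDP _ B0) yB.
apply: norm2_le => [|i]; first by rewrite mulr_ge0.
rewrite !mxE; apply: le_trans (ler_normB _ _) _.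
by have := xB i; have := yB i; lra.
Qed.

Lemma norm1_ge0 u : 0 <= norm1 u. Proof. exact: sumr_ge0. Qed.

Lemma le_norm1D u v : norm1 (u + v) <= norm1 u + norm1 v.
Proof. by rewrite -big_split; apply: ler_sum => i _; rewrite mxE ler_normD. Qed.

Lemma norm1N u : norm1 (- u) = norm1 u.
Proof. by apply: eq_bigr => i _; rewrite mxE normrN. Qed.

Lemma norm2_le_norm1 u : norm2 u <= norm1 u.
Proof.
rewrite -(@ler_pXn2r _ 2) ?nnegrE ?norm2_ge0 ?norm1_ge0// sqr_norm2 expr2.
rewrite [leRHS]mulr_suml; apply: ler_sum => i _.
apply: le_trans (ler_norm _) _; rewrite normrM ler_wpM2l// /norm1 (bigD1 i)//=.
by rewrite lerDl sumr_ge0.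
Qed.

Lemma inD_convex_sum B n (v : nat -> R) (z : nat -> 'rV[R]_d) : 0 <= B ->
  (forall j, (1 <= j <= n)%N -> 0 <= v j /\ inD B (z j)) ->
  \sum_(1 <= j < n.+1) v j = 1 ->
  inD B (\sum_(1 <= j < n.+1) v j *: z j).
Proof.
move=> B0 vz v1; apply/(inDP _ B0) => i; rewrite summxE.
apply: le_trans (ler_norm_sum _ _ _) _.
have -> : B = \sum_(1 <= j < n.+1) v j * B by rewrite -mulr_suml v1 mul1r.
rewrite [leLHS]big_nat_cond [leRHS]big_nat_cond; apply: ler_sum => j.
rewrite andbT ltnS => /vz[vj /(inDP _ B0) zj].
by rewrite mxE normrM (ger0_norm vj) ler_wpM2l.
Qed.

End Vectors.

(** * Maxima of continuous functions on a box *)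

Section BoxCompactness.
Context {R : realType}.

Lemma continuous_mulf (T : topologicalType) (f h : T -> R) :
  continuous f -> continuous h -> continuous (fun v => f v * h v).
Proof. by move=> fc hc v; exact: (cvgM (fc v) (hc v)). Qed.

Lemma continuous_subf (T : topologicalType) (f h : T -> R) :
  continuous f -> continuous h -> continuous (fun v => f v - h v).
Proof. by move=> fc hc v; exact: (cvgB (fc v) (hc v)). Qed.

Lemma continuous_sum (T : topologicalType) (I : Type) (r : seq I) (F : I -> T -> R) :
  (forall i, continuous (F i)) -> continuous (fun v => \sum_(i <- r) F i v).
Proof.
move=> Fc; elim: r => [|i r IH].
  by under eq_fun do rewrite big_nil; exact: cst_continuous.
under eq_fun do rewrite big_cons.
by move=> v; apply: cvgD; [exact: Fc|exact: IH].
Qed.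

Lemma box_maximizer {m : nat} {B : R} {J : 'rV[R]_m -> R} : 0 <= B -> continuous J ->
  exists v : 'rV[R]_m, (forall i, `|v 0 i| <= B) /\
    forall v' : 'rV[R]_m, (forall i, `|v' 0 i| <= B) -> J v' <= J v.
Proof.
move=> B0 Jc.
pose A := [set v : 'rV[R]_m | forall i, `[- B, B]%classic (v ord0 i)].
have AE v : (v \in A) <-> forall i, `|v 0 i| <= B.
  rewrite inE; split => vA i; first by rewrite ler_norml; have := vA i; rewrite /= in_itv.
  by rewrite /= in_itv /= -ler_norml.
have [||//|v /AE vA vmax] := @compact_EVT_max _ R J A.
- by exists 0; apply: set_mem; apply/AE => i; rewrite mxE normr0.
- by apply: (@rV_compact _ _ (fun=> `[- B, B]%classic)) => i; exact: segment_compact.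
- exact: continuous_subspaceT.
by exists v; split => // v' /AE; exact: vmax.
Qed.

End BoxCompactness.

(** * Lazy tracking of a bounded scalar sequence *)

Section LazyTracking.
Context {R : realType}.
Variables (B delta : R) (y : nat -> R).

(** The second test makes the tracker agree with [y] whenever [y] is on a face, so that a small step
    from [y] away from the tracker cannot leave [-B, B]. *)
Fixpoint lazy t : R :=
  if t is t'.+1 then
    if (delta <= `|y t - lazy t'|) || (`|y t| == B) then y t else lazy t'
  else y 0.

Hypotheses (delta_gt0 : 0 < delta) (delta_le : delta <= 2 * B).
Hypothesis yB : forall t, `|y t| <= B.

Lemma lazyS t : lazy t.+1 =
  if (delta <= `|y t.+1 - lazy t|) || (`|y t.+1| == B) then y t.+1 else lazy t.
Proof. by []. Qed.

Lemma lazy_near t : `|y t - lazy t| < delta.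
Proof.
case: t => [|t]; rewrite ?lazyS /=; first by rewrite subrr normr0.
have [far|near] := leP delta `|y t.+1 - lazy t|; first by rewrite subrr normr0.
by rewrite orFb; case: ifP => _ //; rewrite subrr normr0.
Qed.

Lemma lazy_le t : `|lazy t| <= B.
Proof. by elim: t => [|t IH]; rewrite ?lazyS //=; case: ifP. Qed.

Lemma lazy_boundary t : `|y t| = B -> lazy t = y t.
Proof. by case: t => [//|t]; rewrite lazyS => /eqP->; rewrite orbT. Qed.

(** If distance triggers the jump, the gap was below [delta] before [y] moved and is at least
    [delta] after, so [y] moved in the direction of the jump. If a face triggers it, [y t.+1] is an
    endpoint of [-B, B], so both differences point towards it; [y t] is not already there, since the
    tracker would then agree with it. *)
Lemma lazy_aligned t : lazy t.+1 != lazy t ->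
  0 < (lazy t.+1 - lazy t) * (y t.+1 - y t).
Proof.
rewrite lazyS; case: ifP => [|_]; last by rewrite eqxx.
have near := lazy_near t; have yt := yB t; have yt1 := yB t.+1.
have ut := lazy_le t; have bd := @lazy_boundary t.
move: near yt yt1 ut bd; set u := lazy t; set a := y t; set b := y t.+1.
move=> near yt yt1 ut bd /orP[far _|/eqP bB bu].
  case: (ler0P (b - u)) far => bu far; move: near; rewrite ltr_norml => /andP[h1 h2].
    by rewrite nmulr_rgt0; lra.
  by rewrite pmulr_rgt0; lra.
have {bu} bu : b - u != 0 by rewrite subr_eq0.
have ab : a != b by apply: contra bu => /eqP ab; rewrite bd ab ?bB ?subrr.
rewrite -subr_eq0 in ab; move: yt ut; rewrite !ler_norml => /andP[? ?] /andP[? ?].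
case: (ler0P b) bB => b0 bB.
  have u0 : b - u < 0 by rewrite lt_neqAle bu; lra.
  have a0 : b - a < 0 by rewrite lt_neqAle -oppr_eq0 opprB ab; lra.
  by rewrite nmulr_rgt0.
have u0 : 0 < b - u by rewrite lt_neqAle eq_sym bu; lra.
have a0 : 0 < b - a by rewrite lt_neqAle eq_sym -oppr_eq0 opprB ab; lra.
by rewrite pmulr_rgt0.
Qed.

Lemma lazy_changes n :
  delta * \sum_(t < n) (lazy t.+1 != lazy t)%:R
    <= 2 * \sum_(t < n) `|y t.+1 - y t| + delta.
Proof.
have d0 := delta_gt0; have dB := delta_le.
(* Amortization: being on a face is a credit of [delta]. A jump over a distance at least [delta]
   releases [2 * delta] of gap, which pays for the jump and for a credit possibly lost. A shorter
   jump ends on a face and is paid by the credit it creates. *)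
suff : delta * \sum_(t < n) (lazy t.+1 != lazy t)%:R + 2 * `|y n - lazy n|
    <= 2 * \sum_(t < n) `|y t.+1 - y t| + (`|lazy n| == B)%:R * delta.
  have := normr_ge0 (y n - lazy n).
  by case: eqP => _; rewrite ?mulr1n ?mulr0n ?mul1r ?mul0r ?addr0 => h1 h2; lra.
elim: n => [|n]; first by rewrite !big_ord0 /= subrr normr0 !mulr0 !add0r mulr_ge0// ltW.
rewrite !big_ord_recr !mulrDr lazyS /=.
set u := lazy n; set a := y n; set b := y n.+1.
set U := \sum_(i < n) _; set V := \sum_(i < n) _.
have tri : `|b - u| <= `|b - a| + `|a - u| by rewrite ler_distD.
have ba := normr_ge0 (b - a); have au := normr_ge0 (a - u).
have [far|near] := leP delta `|b - u|.
  rewrite /= subrr normr0 mulr0 addr0.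
  have le1 (c : bool) : 0 <= c%:R * delta <= delta.
    by case: c; rewrite ?mulr1n ?mulr0n ?mul1r ?mul0r lexx ltW.
  have /andP[_ cbu] := le1 (b != u); rewrite mulrC in cbu.
  by have /andP[_ cu] := le1 (`|u| == B); have /andP[cb _] := le1 (`|b| == B); lra.
rewrite orFb; have [bB|bB] := eqVneq `|b| B; last first.
  by rewrite eqxx mulr0 addr0; lra.
rewrite bB eqxx mul1r subrr normr0 mulr0 addr0.
have [bu|bu] := eqVneq b u; rewrite /= ?mulr0 ?mulr1.
  by have := normr_ge0 (a - b); rewrite -bu bB eqxx mul1r; lra.
(* a switch between the two faces is at distance 2B >= delta *)
suff /negPf-> : `|u| != B by rewrite mul0r; lra.
apply: contraTneq near => uB; rewrite -leNgt.
have bu' : b <> u by exact/eqP.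
have [b0|b0] := ler0P b; have [u0|u0] := ler0P u; move: bB uB.
- by rewrite (ler0_norm b0) (ler0_norm u0) => bB uB; exfalso; apply: bu'; lra.
- by rewrite (ler0_norm b0) (gtr0_norm u0) ler0_norm; lra.
- by rewrite (gtr0_norm b0) (ler0_norm u0) ger0_norm; lra.
- by rewrite (gtr0_norm b0) (gtr0_norm u0) => bB uB; exfalso; apply: bu'; lra.
Qed.

End LazyTracking.

(** * Perturbations valid for all small step sizes *)

Section SmallSteps.
Context {R : realType}.

(** Each property holds for every step below its threshold, so the least of the finitely many
    thresholds, capped at 1, serves them all. *)
Lemma finite_small_step (I : finType) (P : I -> R -> Prop) :
  (forall i, exists2 e, 0 < e & forall e', 0 < e' <= e -> P i e') ->
  exists2 e, 0 < e <= 1 & forall i, P i e.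
Proof.
move=> HP; have /choice[e He] : forall i, exists e, 0 < e /\
    forall e', 0 < e' <= e -> P i e' by move=> i; have [e] := HP i; exists e.
have m0 : 0 < \big[Num.min/1]_i e i.
  by apply: lt_bigmin => // i _; have [] := He i.
exists (\big[Num.min/1]_i e i); first by rewrite m0 bigmin_le_id.
by move=> i; apply: (He i).2; rewrite m0 bigmin_le_cond.
Qed.

Lemma box_small_step (B y u : R) : `|y| <= B -> `|u| <= B ->
  (`|y| = B -> u = y) ->
  exists2 e, 0 < e & forall e', 0 < e' <= e -> `|y + e' * (y - u)| <= B.
Proof.
move=> yB uB bd; have [yE|yE] := eqVneq `|y| B.
  by exists 1 => // e' _; rewrite bd// subrr mulr0 addr0.
have {}yB : 0 < B - `|y| by rewrite subr_gt0 lt_neqAle yE.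
have B0 : 0 < B by have := normr_ge0 y; lra.
(* As [|y - u| <= 2 * B], such a step moves [y] by at most its distance to the boundary. *)
exists ((B - `|y|) / (2 * B)) => [|e' /andP[e0]]; first by rewrite divr_gt0 ?mulr_gt0.
rewrite ler_pdivlMr ?mulr_gt0// => eB.
apply: le_trans (ler_normD _ _) _; rewrite normrM (gtr0_norm e0).
have : e' * `|y - u| <= e' * (2 * B).
  by rewrite ler_pM2l//; apply: le_trans (ler_normB _ _) _; lra.
lra.
Qed.

(** When p and q have the same sign and e |q| <= |p|, the number (1 + e) p - e q keeps the sign of
    p, and subtracting e q only shrinks it. *)
Lemma aligned_small_step (p q : R) : (q != 0 -> 0 < q * p) ->
  exists2 e, 0 < e & forall e', 0 < e' <= e -> `|p + e' * (p - q)| <= (1 + e') * `|p|.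
Proof.
move=> qp; have [q0|q0] := eqVneq q 0.
  exists 1 => // e' /andP[e0 _]; rewrite q0 subr0 -{1}(mul1r p) -mulrDl normrM.
  by rewrite ger0_norm// addr_ge0// ltW.
have {}qp := qp q0; have p0 : p != 0 by apply: contraTneq qp => ->; rewrite mulr0 ltxx.
exists (`|p| / `|q|) => [|e' /andP[e0]]; first by rewrite divr_gt0 ?normr_gt0.
rewrite ler_pdivlMr ?normr_gt0//.
have [pp|pp] := ltrP 0 p.
  have qq : 0 < q by rewrite pmulr_lgt0 in qp.
  rewrite (gtr0_norm pp) (gtr0_norm qq) => eq; have eq0 := mulr_gt0 e0 qq.
  by rewrite ler_norml; have := mulr_gt0 e0 pp; lra.
have {}pp : p < 0 by rewrite lt_neqAle p0.
have qq : q < 0 by rewrite nmulr_lgt0 in qp.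
rewrite (ltr0_norm pp) (ltr0_norm qq) => eq.
have eq0 : e' * q < 0 by rewrite pmulr_rlt0.
have ep0 : e' * p < 0 by rewrite pmulr_rlt0.
by rewrite ler_norml; lra.
Qed.

End SmallSteps.

(** * Penalized maximizers and piecewise constant comparators *)

Section Variational.
Context {R : realType} {d : nat}.
Variables (B alpha G S : R) (N : nat) (g x : nat -> 'rV[R]_d).
Hypotheses (B_ge1 : 1 <= B) (alpha_gt0 : 0 < alpha) (d_gt0 : (0 < d)%N).
Hypothesis gG : forall t, (t < N.+1)%N -> norm2 (g t) <= G.

(** With [g t] the loss gradient at the prediction [x t], this is the surrogate regret of one round;
    see [surrogate_gain]. Rounds are numbered from 0 to N here. *)
Definition gain t (w : 'rV[R]_d) : R :=
  dotp (g t) (x t - w) - alpha / 2 * dotp (g t) (x t - w) ^+ 2.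
Definition total_gain (w : nat -> 'rV[R]_d) : R := \sum_(t < N.+1) gain t (w t).
Definition TV (w : nat -> 'rV[R]_d) : R := \sum_(t < N) norm1 (w t.+1 - w t).

Hypothesis staticS : forall r s u, (r <= s <= N)%N -> inD B u ->
  \sum_(r <= t < s.+1) gain t u <= S.

Let B_ge0 : 0 <= B. Proof. exact: le_trans ler01 B_ge1. Qed.

Lemma TV_ge0 w : 0 <= TV w.
Proof. by apply: sumr_ge0 => t _; exact: norm1_ge0. Qed.

(** Concavity bounds extrapolation beyond [w] in the opposite direction. For this quadratic the
    exact correction is (alpha / 2) e (1 + e) times the squared slope, at most alpha e times it
    because e <= 1. *)
Lemma gain_extrapolation t (w u : 'rV[R]_d) (e : R) : 0 < e <= 1 ->
  e * (gain t w - gain t u)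
    <= gain t (w + e *: (w - u)) - gain t w + alpha * e * dotp (g t) (w - u) ^+ 2.
Proof.
move=> /andP[e0 e1]; rewrite /gain.
have -> : x t - (w + e *: (w - u)) = (x t - w) - e *: (w - u).
  by rewrite opprD addrA.
have -> : x t - u = (x t - w) + (w - u) by rewrite addrA subrK.
rewrite !(dotpBr, dotpDr, dotpNr, dotpZr).
set a := dotp _ (x t); set b := dotp _ w; set c := dotp _ u.
rewrite -subr_ge0.
set D := (X in 0 <= X).
have -> : D = alpha / 2 * e * (1 - e) * (b - c) ^+ 2 by rewrite /D; field.
have a0 := ltW alpha_gt0; have e0w := ltW e0.
by apply: mulr_ge0 (sqr_ge0 _); rewrite !mulr_ge0 ?subr_ge0.
Qed.

(* First-order optimality of [w] in the direction [w - u], which moves away from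
   the approximation [u]: alignment of the jumps makes the total variation grow by
   at most [e * TV w]. *)
Lemma maximizer_gain_le (lam : R) (w u : nat -> 'rV[R]_d) : 0 <= lam ->
  (forall t, inD B (w t)) -> (forall t, inD B (u t)) ->
  (forall t i, `|w t 0 i| = B -> u t 0 i = w t 0 i) ->
  (forall t i, u t.+1 0 i != u t 0 i ->
     0 < (u t.+1 0 i - u t 0 i) * (w t.+1 0 i - w t 0 i)) ->
  (forall w', (forall t, (t <= N)%N -> inD B (w' t)) ->
     total_gain w' - lam * TV w' <= total_gain w - lam * TV w) ->
  total_gain w <= total_gain u + lam * TV w
     + alpha * \sum_(t < N.+1) dotp (g t) (w t - u t) ^+ 2.
Proof.
move=> lam0 wD uD bd al wmax.
have wD' t i : `|w t 0 i| <= B by move/(inDP _ B_ge0): (wD t).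
have uD' t i : `|u t 0 i| <= B by move/(inDP _ B_ge0): (uD t).
pose P (ti : 'I_N.+1 * 'I_d) e :=
  `|w ti.1 0 ti.2 + e * (w ti.1 0 ti.2 - u ti.1 0 ti.2)| <= B /\
  `|(w ti.1.+1 0 ti.2 - w ti.1 0 ti.2) + e * ((w ti.1.+1 0 ti.2 - w ti.1 0 ti.2)
     - (u ti.1.+1 0 ti.2 - u ti.1 0 ti.2))|
    <= (1 + e) * `|w ti.1.+1 0 ti.2 - w ti.1 0 ti.2|.
have [[t i]|e /andP[e0 e1] He] := @finite_small_step _ _ P.
  have [e1 e10 He1] := box_small_step (wD' t i) (uD' t i) (bd t i).
  have [|e2 e20 He2] := @aligned_small_step R (w t.+1 0 i - w t 0 i) (u t.+1 0 i - u t 0 i).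
    by rewrite subr_eq0; exact: al.
  exists (Num.min e1 e2); first by rewrite lt_min e10.
  by move=> e /andP[e0]; rewrite le_min => /andP[? ?]; split; [apply: He1|apply: He2]; apply/andP.
pose w' t := w t + e *: (w t - u t).
have w'D t : (t <= N)%N -> inD B (w' t).
  rewrite -ltnS => tN; apply/(inDP _ B_ge0) => i; rewrite !mxE.
  by have [] := He (Ordinal tN, i).
have TVw' : TV w' <= (1 + e) * TV w.
  rewrite mulr_sumr; apply: ler_sum => t _; rewrite mulr_sumr; apply: ler_sum => i _.
  have [_] := He (widen_ord (leqnSn N) t, i); rewrite /= => h.
  rewrite !mxE; apply: le_trans h; rewrite le_eqVlt; apply/orP; left; apply/eqP.
  by congr (`| _ |); ring.
have := wmax _ w'D.
have : e * (total_gain w - total_gain u) <= total_gain w' - total_gain w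
    + alpha * e * \sum_(t < N.+1) dotp (g t) (w t - u t) ^+ 2.
  rewrite /total_gain -!sumrB !mulr_sumr -big_split /=.
  by apply: ler_sum => t _; apply: gain_extrapolation; rewrite e0.
have := ler_wpM2l lam0 TVw'.
set Q := \sum_(t < N.+1) _; set W := TV w; set W' := TV w'.
(* All terms are of order [e]: optimality bounds the gain of [w'] over [w] by
   [lam * (W' - W) <= lam * e * W], and [e] cancels. *)
move=> h1 h2 h3; rewrite -(ler_pM2l e0); lra.
Qed.

Definition changes (u : nat -> 'rV[R]_d) n : R := \sum_(t < n) (u t.+1 != u t)%:R.

(** Each maximal constant block of [u] is an interval of rounds with a fixed comparator, to which
    [staticS] applies; there is one more block than changes. *)
Lemma piecewise_gain_le (u : nat -> 'rV[R]_d) : (forall t, inD B (u t)) ->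
  total_gain u <= (1 + changes u N) * S.
Proof.
move=> uD.
(* [r] is the start of the block containing [n]. That block is left out of the sum until it is
   complete, so that [staticS] is applied to whole blocks only. *)
suff key n : (n <= N)%N -> exists r, [/\ (r <= n)%N,
    forall t, (r <= t <= n)%N -> u t = u n &
    \sum_(0 <= t < r) gain t (u t) <= changes u n * S].
  have [r [rN cst le]] := key N (leqnn N).
  rewrite /total_gain -(big_mkord xpredT (fun t => gain t (u t))).
  rewrite (@big_cat_nat _ _ _ r)//=; last exact: leqW.
  rewrite mulrDl mul1r addrC; apply: lerD => //.
  have rNN : (r <= N <= N)%N by rewrite rN leqnn.
  apply: le_trans (staticS rNN (uD N)).
  rewrite [leLHS]big_nat_cond [leRHS]big_nat_cond le_eqVlt; apply/orP; left; apply/eqP.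
  by apply: eq_bigr => t; rewrite andbT ltnS => /cst->.
elim: n => [|n IH] nN; first by exists 0%N; split => // [t|]; [case: t|rewrite big_nil /changes big_ord0 mul0r].
have [r [rn cst le]] := IH (ltnW nN).
have [uE|uE] := eqVneq (u n.+1) (u n).
  exists r; split; first exact: leqW.
    move=> t /andP[rt]; rewrite leq_eqVlt => /predU1P[->//|tn].
    by rewrite uE cst// rt.
  by rewrite /changes big_ord_recr /= uE eqxx addr0.
exists n.+1; split => // [t|]; first by rewrite -eqn_leq => /eqP->.
rewrite /changes big_ord_recr /= uE mulrDl mul1r (@big_cat_nat _ _ _ r)//=; last exact: leqW.
have rnN : (r <= n <= N)%N by rewrite rn ltnW.
apply: lerD => //; apply: le_trans (staticS rnN (uD n)).
rewrite [leLHS]big_nat_cond [leRHS]big_nat_cond le_eqVlt; apply/orP; left; apply/eqP.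
by apply: eq_bigr => t; rewrite andbT ltnS => /cst->.
Qed.
End Variational.

(** * Cube roots *)

Section CubeRoot.
Context {R : realType}.
Implicit Types a b e : R.

Definition cbrt a : R := a `^ 3%:R^-1.

Lemma cbrt_ge0 a : 0 <= cbrt a. Proof. exact: powR_ge0. Qed.

Lemma cbrtK a : 0 <= a -> cbrt a ^+ 3 = a.
Proof.
by move=> a0; rewrite -powR_mulrn ?powR_ge0// -powRrM mulVf ?pnatr_eq0// powRr1.
Qed.

Lemma ler_cbrt a b : 0 <= a -> a <= b -> cbrt a <= cbrt b.
Proof.
move=> a0 ab; have b0 := le_trans a0 ab.
by rewrite -(@ler_pXn2r _ 3) ?nnegrE ?cbrt_ge0// !cbrtK.
Qed.

Lemma cbrtM a b : 0 <= a -> 0 <= b -> cbrt (a * b) = cbrt a * cbrt b.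
Proof. exact: powRM. Qed.

Lemma cbrt_gt0 a : 0 < a -> 0 < cbrt a. Proof. exact: powR_gt0. Qed.

Lemma cbrt_le_self a : 1 <= a -> cbrt a <= a.
Proof. by move=> a1; rewrite -{2}(powRr1 (le_trans ler01 a1)) ler_powR// invf_le1// ler1n. Qed.

Lemma cube_sub_le a b : 0 <= a -> a <= b -> (b - a) ^+ 3 <= b ^+ 3 - a ^+ 3.
Proof. by move=> a0 ab; rewrite -subr_ge0 (_ : _ - _ = 3 * a * b * (b - a)) ?mulr_ge0 ?subr_ge0 ?(le_trans a0 ab)//; ring. Qed.

(** Hölder continuity follows from [cube_sub_le] applied to the roots. It covers the point 0, where
    the cube root is not Lipschitz. *)
Lemma cbrt_dist_le a b : 0 <= a -> 0 <= b -> `|cbrt a - cbrt b| ^+ 3 <= `|a - b|.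
Proof.
wlog ab : a b / b <= a => [h a0 b0|a0 b0].
  have [ba|/ltW ab] := leP b a; first exact: h.
  by rewrite distrC [leRHS]distrC h.
rewrite !ger0_norm ?subr_ge0 ?ler_cbrt//.
by apply: le_trans (cube_sub_le _ _) _; rewrite ?cbrt_ge0 ?ler_cbrt// !cbrtK.
Qed.

Lemma continuous_cbrt_norm : continuous (fun a => cbrt `|a|).
Proof.
move=> a; apply/cvgrPdist_lt => e e0; near=> b.
have ab : `| `|a| - `|b| | < e ^+ 3.
  apply: le_lt_trans (ler_dist_dist _ _) _; near: b.
  by apply: cvgr_dist_lt => //; rewrite exprn_gt0.
rewrite -(@ltr_pXn2r _ 3) ?nnegrE ?normr_ge0 ?(ltW e0)//; apply: le_lt_trans ab.
exact: cbrt_dist_le.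
Unshelve. all: by end_near. Qed.

End CubeRoot.

(** * From static regret on intervals to dynamic regret *)

Section Dynamic.
Context {R : realType} {d : nat}.
Variables (B alpha G S : R) (N : nat) (g x : nat -> 'rV[R]_d).
Hypotheses (B_ge1 : 1 <= B) (alpha_gt0 : 0 < alpha) (d_gt0 : (0 < d)%N).
Hypothesis gG : forall t, (t < N.+1)%N -> norm2 (g t) <= G.
Hypothesis staticS : forall r s u, (r <= s <= N)%N -> inD B u ->
  \sum_(r <= t < s.+1) gain alpha g x t u <= S.
Hypothesis S_ge0 : 0 <= S.

Let B_ge0 : 0 <= B. Proof. exact: le_trans ler01 B_ge1. Qed.

(** Sequences become points of one finite-dimensional box, to which compactness applies. For t > N,
    [inord] falls back on round 0, so the sequence stays in the box at every index. *)
Definition unflatten (v : 'rV[R]_(N.+1 * d)) (t : nat) : 'rV[R]_d :=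
  \row_j v 0 (mxvec_index (inord t) j).

Definition flatten_seq (w : nat -> 'rV[R]_d) : 'rV[R]_(N.+1 * d) :=
  mxvec (\matrix_(t < N.+1) w t).

Lemma flatten_seqK w t : (t <= N)%N -> unflatten (flatten_seq w) t = w t.
Proof. by move=> tN; apply/rowP => j; rewrite mxE mxvecE !mxE inordK. Qed.

Lemma continuous_TV_unflatten : continuous (fun v => TV N (unflatten v)).
Proof.
have -> : (fun v => TV N (unflatten v)) = fun v => \sum_(t < N) \sum_(i < d)
    `|v 0 (mxvec_index (inord t.+1) i) - v 0 (mxvec_index (inord t) i)|.
  by apply/funext => v; do 2![apply: eq_bigr => ? _]; rewrite !mxE.
apply: continuous_sum => t; apply: continuous_sum => i v.
have cB : {for v, continuous (fun v : 'rV[R]_(N.+1 * d) =>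
    v 0 (mxvec_index (inord t.+1) i) - v 0 (mxvec_index (inord t) i))}.
  by apply: continuousB; exact: coord_continuous.
by apply: (continuous_comp cB); exact: norm_continuous.
Qed.

Lemma continuous_gain_unflatten :
  continuous (fun v => total_gain alpha N g x (unflatten v)).
Proof.
pose a t (v : 'rV[R]_(N.+1 * d)) := \sum_(i < d) g t 0 i * (x t 0 i - v 0 (mxvec_index (inord t : 'I_N.+1) i)).
have -> : (fun v => total_gain alpha N g x (unflatten v))
    = fun v => \sum_(t < N.+1) (a t v - alpha / 2 * (a t v * a t v)).
  apply/funext => v; apply: eq_bigr => t _; rewrite /gain expr2.
  suff -> : dotp (g t) (x t - unflatten v t) = a t v by [].
  by apply: eq_bigr => i _; rewrite !mxE.
have ac t : continuous (a t).
  apply: continuous_sum => i; apply: continuous_mulf; first exact: cst_continuous.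
  by apply: continuous_subf; [exact: cst_continuous|exact: coord_continuous].
apply: continuous_sum => t; apply: continuous_subf; first exact: ac.
by apply: continuous_mulf; [exact: cst_continuous|apply: continuous_mulf; exact: ac].
Qed.

Let m : R := cbrt (N.+1%:R * d%:R).
(** With V = c^3 the variation, the tangent penalty at V amounts to two thirds of K c^2. The
    remaining third, m c^2 (2 S + alpha G^2), has to pay for the 2 m c^2 pieces at price S and for
    the tracking error alpha G^2 m c^2; hence the factor 3. *)
Let K : R := 3 * m * (2 * S + alpha * G ^+ 2).

Lemma penalized_maximizer : exists w : nat -> 'rV[R]_d, (forall t, inD B (w t)) /\
  forall w', (forall t, (t <= N)%N -> inD B (w' t)) ->
    total_gain alpha N g x w' - K * cbrt (TV N w') ^+ 2
      <= total_gain alpha N g x w - K * cbrt (TV N w) ^+ 2.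
Proof.
(* The absolute value, harmless on a variation, lets [continuous_cbrt_norm] apply. *)
have Jc : continuous (fun v => total_gain alpha N g x (unflatten v)
    - K * (cbrt `|TV N (unflatten v)| * cbrt `|TV N (unflatten v)|)).
  have cc : continuous (fun v => cbrt `|TV N (unflatten v)|).
    move=> v.
    apply: (@continuous_comp _ _ _ (fun v => TV N (unflatten v)) (fun a => cbrt `|a|) v).
      exact: continuous_TV_unflatten.
    exact: continuous_cbrt_norm.
  apply: continuous_subf; first exact: continuous_gain_unflatten.
  by apply: continuous_mulf; [exact: cst_continuous|exact: continuous_mulf].
have [v [vB vmax]] := box_maximizer B_ge0 Jc.
exists (unflatten v); split => [t|w' w'D].
  by apply/(inDP _ B_ge0) => i; rewrite mxE.
have eqTV : TV N (unflatten (flatten_seq w')) = TV N w'.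
  by apply: eq_bigr => t _; rewrite !flatten_seqK// ltnW.
have eqg : total_gain alpha N g x (unflatten (flatten_seq w')) = total_gain alpha N g x w'.
  by apply: eq_bigr => t _; rewrite flatten_seqK// -ltnS.
have := vmax (flatten_seq w').
rewrite eqTV eqg (ger0_norm (TV_ge0 N w')) (ger0_norm (TV_ge0 N (unflatten v))) -!expr2; apply.
move=> i; case/mxvec_indexP: i => t j.
by rewrite mxvecE mxE; move/(inDP _ B_ge0): (w'D t (ltn_ord t)).
Qed.

Lemma dynamic_gain_le (v : nat -> 'rV[R]_d) : (forall t, (t <= N)%N -> inD B (v t)) ->
  total_gain alpha N g x v
    <= (1 + d%:R) * S
       + 3 * cbrt (N.+1%:R * d%:R) * (2 * S + alpha * G ^+ 2) * cbrt (TV N v) ^+ 2.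
Proof.
move=> vD; have [w [wD wmax]] := penalized_maximizer.
have dR : 0 < d%:R :> R by rewrite ltr0n.
have nR : 0 < N.+1%:R :> R by rewrite ltr0n.
have m0 : 0 < m by rewrite cbrt_gt0// mulr_gt0.
have m3 : m ^+ 3 = N.+1%:R * d%:R by rewrite cbrtK// ltW// mulr_gt0.
have a0 := ltW alpha_gt0.
have aG0 := mulr_ge0 a0 (sqr_ge0 G); have S0 := S_ge0; have m0w := ltW m0.
have K0 : 0 <= K by rewrite /K mulr_ge0// ?mulr_ge0//; lra.
rewrite -/m -/K; suff : total_gain alpha N g x w - K * cbrt (TV N w) ^+ 2 <= (1 + d%:R) * S.
  by have := wmax v vD; lra.
(* At zero variation the penalty has no finite slope, but [w] is then constant and the static bound
   suffices. *)
have [TV0|TV0] := eqVneq (TV N w) 0.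
  have wcst t : (t <= N)%N -> w t = w 0%N.
    elim: t => // t IH tN; rewrite -(IH (ltnW tN)); apply/eqP; rewrite -subr_eq0.
    move/eqP: TV0; rewrite psumr_eq0 => [/allP/(_ (Ordinal tN) (mem_index_enum _))|? _]; last exact: norm1_ge0.
    rewrite /= psumr_eq0 // => /allP h; apply/eqP/rowP => i.
    by have := h i (mem_index_enum _); rewrite /= normr_eq0 => /eqP->; rewrite mxE.
  have h := @staticS 0 N _ (leqnn N) (wD 0%N).
  rewrite lerBlDr; apply: (@le_trans _ _ S).
    apply: le_trans h; rewrite le_eqVlt; apply/orP; left; apply/eqP.
    by rewrite big_mkord; apply: eq_bigr => t _; rewrite wcst// -ltnS.
  by rewrite mulrDl mul1r -addrA lerDl addr_ge0 ?(mulr_ge0 K0 (sqr_ge0 _)) ?mulr_ge0.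
have Vp : 0 < TV N w by rewrite lt_neqAle eq_sym TV0 TV_ge0.
set V := TV N w in Vp TV0 wmax *; set c := cbrt V in wmax *.
have c0 : 0 < c by rewrite cbrt_gt0.
have c3 : c ^+ 3 = V by rewrite cbrtK// ltW.
pose lam := 2 * K / (3 * c).
have c0w := ltW c0.
have lam0 : 0 <= lam by apply: divr_ge0; apply: mulr_ge0.
(* the tangent to the concave penalty [K V^(2/3)] at [V] is a linear penalty *)
have linmax w' : (forall t, (t <= N)%N -> inD B (w' t)) ->
    total_gain alpha N g x w' - lam * TV N w' <= total_gain alpha N g x w - lam * V.
  move=> w'D; have := wmax w' w'D.
  have c'0 := cbrt_ge0 (TV N w'); have := cbrtK (TV_ge0 N w').
  set V' := TV N w' in c'0 *; set c' := cbrt V' in c'0 *; move=> c'3 h.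
  have tangent : 0 <= lam * (V' - V) - K * (c' ^+ 2 - c ^+ 2).
    have -> : lam * (V' - V) - K * (c' ^+ 2 - c ^+ 2)
        = K / (3 * c) * ((c' - c) ^+ 2 * (2 * c' + c)).
      by rewrite /lam -c3 -c'3; field; rewrite gt_eqF.
    apply: mulr_ge0; first by apply: divr_ge0 => //; exact: mulr_ge0.
    by apply: mulr_ge0 (sqr_ge0 _) _; lra.
  lra.
(* This balances the two costs: V / delta and n d delta^2 both equal m c^2. *)
pose delta := c / m.
have delta0 : 0 < delta by rewrite divr_gt0.
have wB t i : `|w t 0 i| <= B by move/(inDP _ B_ge0): (wD t).
(* [lazy_changes] asks for this. Since V <= 2 B N d, delta^3 = V / ((N + 1) d) <= 2 B <= (2 B)^3. *)
have deltaB : delta <= 2 * B.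
  rewrite -(@ler_pXn2r _ 3) ?nnegrE ?(ltW delta0) ?mulr_ge0//.
  rewrite /delta expr_div_n c3 m3 ler_pdivrMr ?mulr_gt0//.
  apply: (@le_trans _ _ (2 * B * (N.+1%:R * d%:R))); last first.
    by rewrite ler_pM2r ?mulr_gt0// ler_eXnr//; have := B_ge1; lra.
  rewrite /V /TV; apply: (@le_trans _ _ (\sum_(t < N) 2 * B * d%:R)).
    apply: ler_sum => t _; rewrite mulr_natr -[d in leRHS]card_ord -sumr_const.
    apply: ler_sum => i _; rewrite !mxE; apply: le_trans (ler_normB _ _) _.
    by have := wB t i; have := wB t.+1 i; lra.
  have -> : \sum_(t < N) 2 * B * d%:R = 2 * B * (N%:R * d%:R).
    by rewrite sumr_const card_ord -[LHS]mulr_natl; ring.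
  by apply: ler_wpM2l; rewrite ?mulr_ge0// ler_pM2r// ler_nat leqnSn.
pose u t : 'rV[R]_d := \row_i lazy B delta (fun t => w t 0 i) t.
have uD t : inD B (u t).
  by apply/(inDP _ B_ge0) => i; rewrite mxE lazy_le// => s; apply: wB.
have := @maximizer_gain_le _ _ B alpha N g x B_ge1 alpha_gt0 lam w u lam0 wD uD _ _ linmax.
have bd t i : `|w t 0 i| = B -> u t 0 i = w t 0 i.
  by move=> wtB; rewrite mxE; apply: lazy_boundary.
have al t i : u t.+1 0 i != u t 0 i ->
     0 < (u t.+1 0 i - u t 0 i) * (w t.+1 0 i - w t 0 i).
  by rewrite !mxE; apply: lazy_aligned => // s; apply: wB.
move=> /(_ bd al) main.
have dev : \sum_(t < N.+1) dotp (g t) (w t - u t) ^+ 2 <= G ^+ 2 * (m * c ^+ 2).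
  have -> : G ^+ 2 * (m * c ^+ 2) = \sum_(t < N.+1) G ^+ 2 * (d%:R * delta ^+ 2).
    rewrite sumr_const card_ord -[RHS]mulr_natl /delta expr_div_n.
    have -> : N.+1%:R * (G ^+ 2 * (d%:R * (c ^+ 2 / m ^+ 2)))
      = (N.+1%:R * d%:R) * (G ^+ 2 * c ^+ 2 / m ^+ 2) by field; rewrite gt_eqF.
    by rewrite -m3; field; rewrite gt_eqF.
  apply: ler_sum => t _; apply: le_trans (dotp_CauchySchwarz _ _) _.
  apply: ler_pM; rewrite ?dotpp_ge0//.
    rewrite -sqr_norm2 ler_pXn2r ?nnegrE ?norm2_ge0 ?gG//.
    exact: le_trans (norm2_ge0 _) (gG (ltn_ord t)).
  rewrite mulr_natl -[d in leRHS]card_ord -sumr_const; apply: ler_sum => i _.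
  rewrite !mxE -expr2 -(real_normK (num_real _)) ler_pXn2r ?nnegrE ?(ltW delta0)//.
  by rewrite ltW//; apply: lazy_near.
(* Every change of the vector [u] is charged to a coordinate that changes; the additive [delta] of
   each coordinate produces the term [d]. *)
have chg : changes u N <= 2 * (m * c ^+ 2) + d%:R.
  rewrite -(ler_pM2l delta0).
  have -> : delta * (2 * (m * c ^+ 2) + d%:R) = 2 * V + d%:R * delta.
    by rewrite -c3 /delta; field; rewrite gt_eqF.
  have cl i := @lazy_changes _ B delta (fun t => w t 0 i) delta0 deltaB N.
  have : \sum_(i < d) delta * \sum_(t < N) (u t.+1 0 i != u t 0 i)%:R
      <= \sum_(i < d) (2 * \sum_(t < N) `|w t.+1 0 i - w t 0 i| + delta).
    by apply: ler_sum => i _; under eq_bigr do rewrite !mxE; exact: cl.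
  rewrite big_split /= sumr_const card_ord -!mulr_sumr -[delta *+ d]mulr_natl.
  rewrite [X in _ <= 2 * X + _ -> _]exchange_big /=.
  have -> : \sum_(j < N) \sum_(i < d) `|w j.+1 0 i - w j 0 i| = V.
    by apply: eq_bigr => t _; apply: eq_bigr => i _; rewrite !mxE.
  apply: le_trans; rewrite ler_pM2l// exchange_big /=.
  apply: ler_sum => t _; have [/eqP ut|ut] := boolP (u t.+1 == u t).
    by rewrite mulr0n sumr_ge0.
  have [i ui] : exists i, u t.+1 0 i != u t 0 i.
    apply: contrapT => h; move/eqP: ut; apply; apply/rowP => i; apply/eqP.
    by apply: contrapT => ui; apply: h; exists i; apply/negP.
  rewrite (bigD1 i)//= ui.
  by rewrite lerDl sumr_ge0.
have pw := @piecewise_gain_le _ _ B alpha S N g x staticS u uD.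
have := ler_wpM2r S_ge0 chg.
have lamV : lam * V = 2 * K / 3 * c ^+ 2.
  by rewrite /lam -c3; field; rewrite gt_eqF.
have KE : K * c ^+ 2 = 3 * (m * c ^+ 2) * (2 * S + alpha * G ^+ 2) by rewrite /K; ring.
have := ler_wpM2l a0 dev.
move: main pw; rewrite -/V lamV.
move: KE; set X := m * c ^+ 2; set Y := c ^+ 2.
by move=> KE h1 h2 h3 h4; lra.
Qed.

End Dynamic.

(** * Determinant bounds and rank-one updates *)

Section DeterminantBounds.
Context {R : realType} {d : nat}.
Implicit Types (A : 'M[R]_d) (g c : 'rV[R]_d).

(** It takes the place of the trace in the usual determinant bound; a rank-one update then costs d
    |g|^2 instead of |g|^2, which only matters inside a logarithm. *)
Definition entry_sum A : R := \sum_i \sum_j `|A i j|.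

(* Leibniz' formula is dominated by the expansion of the product of the row sums,
   to which the arithmetic-geometric mean inequality applies. *)
Lemma det_le_entry_sum A : (0 < d)%N -> \det A <= (entry_sum A / d%:R) ^+ d.
Proof.
move=> d0; apply: le_trans (ler_norm _) _.
apply: (@le_trans _ _ (\prod_i \sum_j `|A i j|)).
  rewrite bigA_distr_bigA /=; apply: le_trans (ler_norm_sum _ _ _) _.
  rewrite (eq_bigr (fun s : {perm 'I_d} => \prod_i `|A i (pval s i)|)); last first.
    move=> s _; rewrite normrM normrX normrN1 expr1n mul1r normr_prod.
    by apply: eq_bigr => i _; rewrite pvalE.
  have -> : \sum_(s : {perm 'I_d}) \prod_i `|A i (pval s i)|
      = \sum_(f in (@pval 'I_d) @: predT) \prod_i `|A i (f i)|.
    by rewrite big_imset //= => s t _ _; exact: val_inj.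
  rewrite [leRHS](bigID (mem ((@pval 'I_d) @: predT))) /= lerDl.
  by apply: sumr_ge0 => f _; apply: prodr_ge0.
have [] := @leif_AGM R _ predT (fun i => \sum_j `|A i j|).
  by move=> i _; apply: sumr_ge0.
by rewrite cardT size_enum_ord.
Qed.

Lemma entry_sum_scalar (a : R) : 0 <= a -> entry_sum (a%:M) = d%:R * a.
Proof.
move=> a0; rewrite mulr_natl -[d in RHS]card_ord -sumr_const; apply: eq_bigr => i _.
rewrite (bigD1 i)//= mxE eqxx mulr1n ger0_norm// big1 ?addr0// => j ji.
by rewrite mxE eq_sym (negbTE ji) mulr0n normr0.
Qed.

Lemma sqr_norm1_le g : norm1 g ^+ 2 <= d%:R * dotp g g.
Proof.
have := dotp_CauchySchwarz (\row_i `|g 0 i|) (const_mx 1).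
have -> : dotp (\row_i `|g 0 i|) (const_mx 1) = norm1 g.
  by apply: eq_bigr => i _; rewrite !mxE mulr1.
have -> : dotp (\row_i `|g 0 i|) (\row_i `|g 0 i|) = dotp g g.
  by apply: eq_bigr => i _; rewrite !mxE -normrM ger0_norm// -expr2 sqr_ge0.
have -> : dotp (const_mx 1 : 'rV[R]_d) (const_mx 1) = d%:R.
  transitivity (\sum_(i < d) (1 : R)); last by rewrite sumr_const card_ord.
  by apply: eq_bigr => i _; rewrite !mxE mulr1.
by rewrite mulrC.
Qed.

Lemma entry_sum_rank1 A g : entry_sum (A + g^T *m g) <= entry_sum A + d%:R * dotp g g.
Proof.
apply: (@le_trans _ _ (entry_sum A + norm1 g ^+ 2)); last by rewrite lerD2l sqr_norm1_le.
rewrite expr2 {1}/norm1 mulr_suml -big_split; apply: ler_sum => i _ /=.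
rewrite mulr_sumr -big_split; apply: ler_sum => j _ /=.
rewrite mxE; apply: le_trans (ler_normD _ _) _; rewrite lerD2l.
by rewrite mxE big_ord1 mxE normrM.
Qed.

(** Matrix determinant lemma, from two block triangular factorizations of the block matrix with rows
    (A, -c^T) and (g, 1). *)
Lemma det_rank1_update A c g : A \in unitmx ->
  \det (A + c^T *m g) = \det A * (1 + (g *m invmx A *m c^T) 0 0).
Proof.
move=> Au; pose M := block_mx A (- c^T) g (1%:M : 'M[R]_1).
have M1 : M = block_mx 1%:M 0 (g *m invmx A) 1%:M
    *m block_mx A (- c^T) 0 (1%:M + g *m invmx A *m c^T).
  rewrite mulmx_block !mul1mx !mul0mx !addr0 mulmxKV//.
  by rewrite mulmxN addrCA addNr addr0.
have M2 : M = block_mx 1%:M (- c^T) 0 1%:M *m block_mx (A + c^T *m g) 0 g 1%:M.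
  by rewrite mulmx_block !mul1mx !mul0mx !mulmx1 !add0r mulNmx addrK.
have := congr1 determinant M1; rewrite {1}M2 !det_mulmx !det_ublock !det_lblock !det1.
rewrite !(mul1r, mulr1) => ->; congr (_ * _).
by rewrite det_mx11 mxE mxE eqxx.
Qed.

End DeterminantBounds.

(** * Quadratic forms and generalized projection onto the box *)

Section QuadraticForms.
Context {R : realType} {d : nat}.
Implicit Types (A : 'M[R]_d) (u v w z g : 'rV[R]_d).

Definition bilf A u v : R := (u *m A *m v^T) 0 0.

Lemma quadfE A u : quadf A u = bilf A u u. Proof. by []. Qed.

Lemma dotpE u v : dotp u v = (u *m v^T) 0 0.
Proof. by rewrite mxE; apply: eq_bigr => i _; rewrite mxE. Qed.

Lemma bilfC A u v : A^T = A -> bilf A u v = bilf A v u.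
Proof.
move=> As; rewrite /bilf.
have -> : (u *m A *m v^T) 0 0 = (u *m A *m v^T)^T 0 0 by rewrite [RHS]mxE.
by rewrite (trmx_mul (u *m A)) trmxK trmx_mul As mulmxA.
Qed.

Lemma quadfB A u v : A^T = A ->
  quadf A (u - v) = quadf A u - 2 * bilf A u v + quadf A v.
Proof.
move=> As; rewrite !quadfE {1}/bilf linearB /= !mulmxBl !mulmxBr.
have -> : forall M N P Q : 'M[R]_1, (M - N - (P - Q)) 0 0 = M 0 0 - N 0 0 - P 0 0 + Q 0 0.
  by move=> M N P Q; rewrite !mxE; ring.
by rewrite -!/(bilf _ _ _) (bilfC v u As); ring.
Qed.

Lemma quadfZ A a u : quadf A (a *: u) = a ^+ 2 * quadf A u.
Proof. by rewrite /quadf linearZ /= -!scalemxAl -scalemxAr !mxE; ring. Qed.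

Lemma bilfZr A a u v : bilf A u (a *: v) = a * bilf A u v.
Proof. by rewrite /bilf linearZ /= -scalemxAr mxE. Qed.

Lemma quadfN A u : quadf A (- u) = quadf A u.
Proof. by rewrite -scaleN1r quadfZ sqrrN expr1n mul1r. Qed.

Lemma quadf_ons_A A g u : quadf (ons_A A g) u = quadf A u + dotp g u ^+ 2.
Proof.
rewrite /quadf /ons_A mulmxDr mulmxDl mxE; congr (_ + _).
rewrite mulmxA -(mulmxA (u *m g^T)) mxE big_ord1 -!dotpE.
by rewrite dotpC expr2.
Qed.

Lemma quadf_scalar a u : quadf a%:M u = a * dotp u u.
Proof. by rewrite /quadf mul_mx_scalar -scalemxAl mxE dotpE. Qed.

Lemma continuous_quadf A w : continuous (fun z => quadf A (w - z)).
Proof.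
have -> : (fun z => quadf A (w - z)) = fun z =>
    \sum_j (\sum_i (w 0 i - z 0 i) * A i j) * (w 0 j - z 0 j).
  apply/funext => z; rewrite /quadf mxE; apply: eq_bigr => j _.
  by rewrite !mxE; congr (_ * _); apply: eq_bigr => i _; rewrite !mxE.
have cs i : continuous (fun z : 'rV[R]_d => w 0 i - z 0 i).
  by apply: continuous_subf; [exact: cst_continuous|exact: coord_continuous].
apply: continuous_sum => j; apply: continuous_mulf => //.
apply: continuous_sum => i; apply: continuous_mulf => //.
exact: cst_continuous.
Qed.

(** A minimizer exists by compactness, so [xget] does not return its default [w]. *)
Lemma projAP B A w : 0 <= B -> inD B (projA B A w) /\
  forall y, inD B y -> quadf A (w - projA B A w) <= quadf A (w - y).
Proof.
move=> B0.
have ncont : continuous (fun z => 0 - quadf A (w - z)).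
  by apply: continuous_subf; [exact: cst_continuous|exact: continuous_quadf].
have [z [zB zmax]] := box_maximizer B0 ncont.
suff : [set z | inD B z /\ forall y, inD B y -> quadf A (w - z) <= quadf A (w - y)]
    (projA B A w) by [].
apply: (@xgetPex _ w); exists z; split; first exact/(inDP _ B0).
by move=> y /(inDP _ B0)/zmax; lra.
Qed.

(** The angle at the projection z between w - z and u - z is not acute for A; expanding the form at
    (w - z) - (u - z) gives the claim. *)
Lemma projA_contracts B A w u : 0 <= B -> A^T = A -> (forall v, 0 <= quadf A v) ->
  inD B u -> quadf A (projA B A w - u) <= quadf A (w - u).
Proof.
move=> B0 As A0 uD; have [zD zmin] := projAP A w B0.
move: zD zmin; set z := projA B A w => zD zmin.
have b0 : bilf A (w - z) (u - z) <= 0.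
  set b := bilf _ _ _; rewrite leNgt; apply/negP => b0.
  have q0 := A0 (u - z); set q := quadf A (u - z) in q0.
  (* If b > 0, moving from z towards u by th changes the form by th^2 q - 2 th b. This th makes it -
     th b - th^2 b < 0, against minimality, and is well defined even for q = 0. *)
  have [th [th0 th1 qb]] : exists th, [/\ 0 < th, th <= 1 & th * (q + b) = b].
    exists (b / (q + b)); have qb0 : 0 < q + b by lra.
    by rewrite divr_gt0// ler_pdivrMr// divfK ?gt_eqF//; split => //; lra.
  have yD : inD B (z + th *: (u - z)).
    apply/(inDP _ B0) => i; rewrite !mxE.
    have := (inDP z B0).1 zD i; have := (inDP u B0).1 uD i.
    have -> : z 0 i + th * (u 0 i - z 0 i) = (1 - th) * z 0 i + th * u 0 i by ring.
    move=> ui zi; apply: le_trans (ler_normD _ _) _; rewrite !normrM.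
    rewrite (ger0_norm (ltW th0)) ger0_norm ?subr_ge0//.
    have -> : B = (1 - th) * B + th * B by ring.
    by rewrite lerD// ler_wpM2l ?subr_ge0// ltW.
  have := zmin _ yD; rewrite opprD addrA (quadfB (w - z) _ As) quadfZ bilfZr -/b -/q.
  have -> : th ^+ 2 * q = th * (th * (q + b)) - th * (th * b) by ring.
  have := mulr_gt0 th0 b0; have := mulr_gt0 th0 (mulr_gt0 th0 b0); rewrite qb; lra.
rewrite (_ : w - u = (w - z) - (u - z)); last by rewrite opprB addrA subrK.
rewrite (quadfB (w - z) _ As) -[quadf A (z - u)]quadfN opprB.
have := A0 (w - z); lra.
Qed.

End QuadraticForms.

(** * One step of Online Newton Step *)

Section ONSStep.
Context {R : realType} {d : nat}.
Implicit Types (A : 'M[R]_d) (u z g : 'rV[R]_d).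

(** Equivalent to symmetric positive definite; the determinant condition gives invertibility
    directly and is the quantity the log-determinant potential tracks. *)
Definition posdef A := [/\ A^T = A, forall u, 0 <= quadf A u & 0 < \det A].

Lemma posdef_unit A : posdef A -> A \in unitmx.
Proof. by case=> _ _ dA; rewrite unitmxE unitfE gt_eqF. Qed.

Lemma posdef_scalar (a : R) : 0 < a -> posdef a%:M.
Proof.
move=> a0; split; first by rewrite tr_scalar_mx.
  by move=> u; rewrite quadf_scalar mulr_ge0 ?dotpp_ge0// ltW.
by rewrite det_scalar exprn_gt0.
Qed.

Lemma quadf_invmx A g : posdef A ->
  quadf A (g *m invmx A) = (g *m invmx A *m g^T) 0 0.
Proof.
move=> Ap; have [As _ _] := Ap; have Au := posdef_unit Ap.
by rewrite /quadf mulmxKV// trmx_mul trmx_inv As mulmxA.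
Qed.

Lemma posdef_ons_A A g : posdef A -> posdef (ons_A A g).
Proof.
move=> Ap; have [As A0 dA] := Ap; split.
- by rewrite /ons_A linearD /= trmx_mul trmxK As.
- by move=> u; rewrite quadf_ons_A addr_ge0// sqr_ge0.
rewrite /ons_A det_rank1_update ?posdef_unit// mulr_gt0//.
by rewrite ltr_pwDl// -quadf_invmx.
Qed.

(** Removing the rank-one term from A' = A + g^T g gives det A = det A' (1 - h), h being the
    left-hand side; then ln (1 - h) <= - h. *)
Lemma leverage_le_ln A g : posdef A ->
  (g *m invmx (ons_A A g) *m g^T) 0 0 <= ln (\det (ons_A A g)) - ln (\det A).
Proof.
move=> Ap; have [_ _ dA] := Ap; have A'p := posdef_ons_A g Ap; have [_ _ dA'] := A'p.
set h := (X in X <= _).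
have dE : \det A = \det (ons_A A g) * (1 - h).
  have {1}-> : A = ons_A A g + (- g)^T *m g by rewrite /ons_A linearN /= mulNmx addrK.
  by rewrite det_rank1_update ?posdef_unit// linearN /= mulmxN mxE.
have h1 : 0 < 1 - h by rewrite dE pmulr_rgt0 in dA.
rewrite dE lnM ?posrE// opprD addrA subrr add0r lerNr.
by apply: le_ln1Dx; lra.
Qed.

Variables (B beta : R).
Hypotheses (B_ge0 : 0 <= B) (beta_gt0 : 0 < beta).

Lemma ons_z_in A z g : inD B (ons_z B beta A z g).
Proof. exact: (projAP _ _ B_ge0).1. Qed.

Definition ons_potential u A z : R :=
  beta / 2 * quadf A (z - u) - (2 * beta)^-1 * ln (\det A).

(** Projection does not increase the A'-distance to u. Expanding this squared distance after the
    Newton step gives the linear term, the square added by g^T g, and beta^-2 times the leverage of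
    g, which the growth of the log-determinant pays for. *)
Lemma ons_step_regret A z g u : posdef A -> inD B u ->
  dotp g (z - u) - beta / 2 * dotp g (z - u) ^+ 2
    <= ons_potential u A z - ons_potential u (ons_A A g) (ons_z B beta A z g).
Proof.
move=> Ap uD; have A'p := posdef_ons_A g Ap; have [A's A'0 _] := A'p.
have lev := leverage_le_ln g Ap.
have := projA_contracts (z - beta^-1 *: (invmx (ons_A A g) *m g^T)^T) B_ge0 A's A'0 uD.
rewrite -/(ons_z B beta A z g); set z' := ons_z _ _ _ _ _; set A' := ons_A A g in lev A's A'p *.
rewrite trmx_mul trmxK trmx_inv A's addrAC (quadfB (z - u) _ A's) quadfZ bilfZr.
rewrite (quadf_invmx _ A'p) (bilfC _ _ A's) {1}/bilf mulmxKV ?posdef_unit// -dotpE.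
rewrite [quadf A' (z - u)]quadf_ons_A /ons_potential.
set h := (X in _ + _ * X) in lev *; set G := dotp g _; set q := quadf A _; set q' := quadf A' _.
set L := ln _ in lev *; set L' := ln _ in lev *.
move=> H; have := ler_wpM2l (divr_ge0 (ltW beta_gt0) (ler0n R 2)) H.
have -> : beta / 2 * (q + G ^+ 2 - 2 * (beta^-1 * G) + beta^-1 ^+ 2 * h)
   = beta / 2 * q + beta / 2 * G ^+ 2 - G + (2 * beta)^-1 * h.
  by field; rewrite gt_eqF.
have : (2 * beta)^-1 * h <= (2 * beta)^-1 * (L - L').
  by apply: ler_wpM2l lev; rewrite invr_ge0 mulr_ge0// ltW.
lra.
Qed.

End ONSStep.

(** * The surrogate losses and the constant gamma *)

Section Surrogate.
Context {R : realType} {d : nat}.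
Variables (B G alpha : R).
Implicit Types g xt x w : 'rV[R]_d.
Hypotheses (B_ge1 : 1 <= B) (G_ge1 : 1 <= G) (alpha_gt0 : 0 < alpha) (d_gt0 : (0 < d)%N).

Let s : R := Num.sqrt (alpha / 2).
Let gamma : R := gammaP d B G alpha.

Let s_gt0 : 0 < s. Proof. by rewrite sqrtr_gt0 divr_gt0. Qed.
Let s_sqr : s ^+ 2 = alpha / 2. Proof. by rewrite sqr_sqrtr// ltW// divr_gt0. Qed.

Let sqrt2alpha : Num.sqrt (2 * alpha) = 2 * s.
Proof.
have -> : 2 * alpha = 2 ^+ 2 * (alpha / 2) by field.
by rewrite sqrtrM ?sqr_ge0// sqrtr_sqr ger0_norm.
Qed.

(** The affine function whose square is the surrogate; (2 s)^-1 is 1 / sqrt (2 alpha). *)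
Definition margin g xt x : R := s * dotp g (x - xt) + (2 * s)^-1.

Lemma surrogateE g xt x : surrogate alpha g xt x = margin g xt x ^+ 2.
Proof. by rewrite /surrogate /margin sqrt2alpha div1r. Qed.

Lemma gammaE : gamma = 2 * G * B * Num.sqrt d%:R * s + (2 * s)^-1.
Proof.
rewrite /gamma /gammaP sqrt2alpha div1r (_ : alpha * d%:R / 2 = d%:R * (alpha / 2)).
  by rewrite sqrtrM ?ler0n// -/s; ring.
by ring.
Qed.

Lemma gamma_gt0 : 0 < gamma.
Proof.
have G0 := lt_le_trans ltr01 G_ge1; have B0 := lt_le_trans ltr01 B_ge1.
by rewrite gammaE ltr_wpDl ?mulr_ge0 ?sqrtr_ge0 ?(ltW G0) ?(ltW B0) ?(ltW s_gt0)// invr_gt0 mulr_gt0.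
Qed.

Lemma gamma_sqr_le : gamma ^+ 2 <= 4 * G ^+ 2 * B ^+ 2 * alpha * d%:R + 1 / alpha.
Proof.
rewrite gammaE; set p := 2 * G * B * _ * s; set q := (2 * s)^-1.
have pE : p ^+ 2 = 2 * G ^+ 2 * B ^+ 2 * alpha * d%:R.
  by rewrite /p !exprMn s_sqr sqr_sqrtr ?ler0n//; field.
have qE : q ^+ 2 = (2 * alpha)^-1.
  by rewrite /q exprVn exprMn s_sqr; congr (_^-1); field.
have -> : 1 / alpha = 2 * q ^+ 2 by rewrite qE; field; rewrite gt_eqF.
by have := sqr_ge0 (p - q); rewrite sqrrB sqrrD pE; lra.
Qed.

Lemma gamma_sqr_ge : 2 * G ^+ 2 * B ^+ 2 * alpha * d%:R <= gamma ^+ 2.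
Proof.
have G0 := lt_le_trans ltr01 G_ge1; have B0 := lt_le_trans ltr01 B_ge1.
rewrite gammaE; set p := 2 * G * B * _ * s; set q := (2 * s)^-1.
have -> : 2 * G ^+ 2 * B ^+ 2 * alpha * d%:R = p ^+ 2.
  by rewrite /p !exprMn s_sqr sqr_sqrtr ?ler0n//; field.
have p0 : 0 <= p by rewrite !mulr_ge0 ?sqrtr_ge0 ?(ltW G0) ?(ltW B0) ?(ltW s_gt0).
have q0 : 0 <= q by rewrite invr_ge0 mulr_ge0// ltW.
by rewrite ler_pXn2r ?nnegrE ?addr_ge0// lerDl.
Qed.

(** The offset (2 s)^-1 makes the coefficient of the linear term exactly 1, so the right-hand side
    is the upper bound on the loss regret provided by Assumption B1. *)
Lemma surrogate_gain g xt w : surrogate alpha g xt xt - surrogate alpha g xt w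
  = dotp g (xt - w) - alpha / 2 * dotp g (xt - w) ^+ 2.
Proof.
rewrite !surrogateE /margin subrr dotp0r -s_sqr -(opprB xt w) dotpNr.
by field; rewrite gt_eqF.
Qed.

(** Cauchy-Schwarz with the diameter 2 B sqrt d of the box; [gamma] is this bound on the linear part
    plus the offset. *)
Lemma margin_le g xt x : norm2 g <= G -> inD B xt -> inD B x ->
  `|margin g xt x| <= gamma.
Proof.
move=> gG xtD xD; have B0 : 0 <= B := le_trans ler01 B_ge1.
apply: le_trans (ler_normD _ _) _; rewrite gammaE; apply: lerD; last first.
  by rewrite ger0_norm// invr_ge0 mulr_ge0// ltW.
rewrite normrM gtr0_norm// mulrC ler_pM2r//.
apply: le_trans (norm_dotp_le _ _) _.
have -> : 2 * G * B * Num.sqrt d%:R = G * (2 * B * Num.sqrt d%:R) by ring.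
by apply: ler_pM; rewrite ?norm2_ge0// norm2_sub_le.
Qed.

Lemma grad_surrogate g xt x :
  grad (surrogate alpha g xt) x = (2 * margin g xt x * s) *: g.
Proof.
have lin : linear (fun v : 'rV[R]_d => s * dotp g v : R).
  by move=> a u v; rewrite dotpDr dotpZr mulrDr mulrCA.
pose lM := GRing.isLinear.Build _ _ _ _ _ lin.
pose l : {linear 'rV[R]_d -> R} := HB.pack (fun v : 'rV[R]_d => s * dotp g v : R) lM.
have lc : continuous l.
  apply: continuous_mulf; first exact: cst_continuous.
  apply: continuous_sum => i; apply: continuous_mulf; first exact: cst_continuous.
  exact: coord_continuous.
have ld : is_diff x l l.
  by apply: DiffDef; [exact: linear_differentiable|rewrite diff_lin].
pose h : 'rV[R]_d -> R := (l : 'rV[R]_d -> R) + cst ((2 * s)^-1 - s * dotp g xt).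
have hE : margin g xt = h.
  by apply/funext => v; rewrite /margin /h fctE /= dotpBr mulrBr; ring.
have -> : surrogate alpha g xt = h ^+ 2.
  by apply/funext => v; rewrite surrogateE hE exprfctE.
have hd : is_diff x (h ^+ 2) (2%:R * h x ^+ 1 *: ((l : 'rV[R]_d -> R) + (0 : 'rV[R]_d -> R))).
  exact: is_diffX.
apply/rowP => i; rewrite !mxE diff_val hE expr1.
by rewrite -[LHS]/(2 * h x * (s * dotp g (delta_mx 0 i) + 0)) dotp_delta addr0 mulrA.
Qed.

End Surrogate.

(** * A tangent inequality for the Gaussian function *)

Section ExpTangent.
Context {R : realType}.

(* [(1 + q^2 - q p) exp((p^2 - q^2) / 2)] has derivative of the sign of [p - q]
   on [-1, 1], hence its minimum is its value [1] at [p = q]. *)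
Lemma expR_gauss_tangent (p q : R) : `|p| <= 1 -> 0 <= q <= 1 ->
  expR (- ((p ^+ 2 - q ^+ 2) / 2)) <= 1 - q * (p - q).
Proof.
move=> p1 /andP[q0 q1].
pose F p := (1 + q ^+ 2 - q * p) * expR ((p ^+ 2 - q ^+ 2) / 2).
pose F' p := (p - q) * (1 - p * q) * expR ((p ^+ 2 - q ^+ 2) / 2).
have dF x : is_derive x (1 : R) F (F' x).
  by apply: is_derive_eq; rewrite /F' /GRing.scale /=; field.
have dF1 x : derive1 F x = F' x by rewrite derive1E; exact: derive_val.
have cF : continuous F.
  by move=> x; apply: differentiable_continuous; apply/derivable1_diffP; exact: ex_derive.
have Fq : F q = 1 by rewrite /F subrr mul0r expR0; ring.
have pq x : `|x| <= 1 -> 0 <= 1 - x * q.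
  move=> x1; rewrite subr_ge0; apply: le_trans (ler_norm _) _.
  by rewrite normrM (ger0_norm q0) mulr_ile1.
suff F1 : 1 <= F p.
  have e0 := expR_gt0 ((p ^+ 2 - q ^+ 2) / 2).
  rewrite expRN -(ler_pM2r e0) mulVf ?gt_eqF//.
  by apply: le_trans F1 _; rewrite /F le_eqVlt; apply/orP; left; apply/eqP; ring.
move: p1; rewrite ler_norml => /andP[pN1 p1]; rewrite -Fq.
have [qp|/ltW qp] := leP q p.
  apply: (@ger0_derive1_le_cc _ F q 1) => //; rewrite ?in_itv /= ?lexx ?q1 ?qp//.
  - by move=> x; rewrite in_itv /= => /andP[qx x1]; rewrite dF1 !mulr_ge0 ?expR_ge0 ?pq//;
      rewrite ?ler_norml; lra.
  - exact: continuous_subspaceT.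
apply: (@ler0_derive1_le_cc _ F (- 1) q) => //; rewrite ?in_itv /= ?lexx ?pN1 ?qp//.
- move=> x; rewrite in_itv /= => /andP[x1 xq]; rewrite dF1 /F' -mulrA mulr_le0_ge0//; first by lra.
  by rewrite mulr_ge0 ?expR_ge0// pq// ler_norml; lra.
- exact: continuous_subspaceT.
- by rewrite andbT; lra.
Qed.

End ExpTangent.

(** * Exp-concavity and curvature of the surrogates *)

Section SurrogateCurvature.
Context {R : realType} {d : nat}.
Variables (B G alpha : R).
Implicit Types g xt x z u : 'rV[R]_d.
Hypotheses (B_ge1 : 1 <= B) (G_ge1 : 1 <= G) (alpha_gt0 : 0 < alpha) (d_gt0 : (0 < d)%N).

Let s : R := Num.sqrt (alpha / 2).
Let gamma : R := gammaP d B G alpha.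
Let eta : R := etaP d B G alpha.
Let zeta : R := zetaP d B G alpha.

Let s_gt0 : 0 < s. Proof. by rewrite sqrtr_gt0 divr_gt0. Qed.
Let gamma0 : 0 < gamma. Proof. exact: gamma_gt0. Qed.

Lemma eta_gt0 : 0 < eta.
Proof. by rewrite divr_gt0// mulr_gt0// exprn_gt0. Qed.

Lemma zeta_gt0 : 0 < zeta.
Proof.
have G0 := lt_le_trans ltr01 G_ge1; have B0 := lt_le_trans ltr01 B_ge1.
rewrite lt_min !divr_gt0 ?mulr_gt0 ?exprn_gt0//.
by rewrite sqrtr_gt0 ltr0n.
Qed.

Lemma zeta_le : zeta <= 1 / (4 * gamma ^+ 2).
Proof. by rewrite ge_min lexx orbT. Qed.

(** This is [expR_gauss_tangent] for the margins at x and xt divided by [gamma], since eta = 1 / (2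
    gamma^2). The margin at xt is the positive offset, as q >= 0 demands. *)
Lemma surrogate_exp_tangent g xt x : norm2 g <= G -> inD B xt -> inD B x ->
  expR (- eta * surrogate alpha g xt x)
    <= expR (- eta * surrogate alpha g xt xt) * (1 - eta * dotp g (x - xt)).
Proof.
move=> gG xtD xD; have yx := margin_le B_ge1 alpha_gt0 gG xtD xD.
have yt := margin_le B_ge1 alpha_gt0 gG xtD xtD.
rewrite !surrogateE//; move: yx yt; rewrite -/gamma.
have mt : margin alpha g xt xt = (2 * s)^-1 by rewrite /margin subrr dotp0r mulr0 add0r.
have mx : margin alpha g xt x = s * dotp g (x - xt) + (2 * s)^-1 by [].
set y := margin alpha g xt x in mx *; set c := margin alpha g xt xt in mt *.
move=> yg cg; have c0 : 0 <= c by rewrite mt invr_ge0 mulr_ge0// ltW.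
have gn0 : gamma != 0 by rewrite gt_eqF.
have p1 : `|y / gamma| <= 1.
  by rewrite normrM normfV (gtr0_norm gamma0) ler_pdivrMr// mul1r.
have q1 : 0 <= c / gamma <= 1.
  rewrite divr_ge0 ?(ltW gamma0)//= ler_pdivrMr// mul1r.
  by apply: le_trans cg; exact: ler_norm.
have := expR_gauss_tangent p1 q1.
have -> : c / gamma * (y / gamma - c / gamma) = eta * dotp g (x - xt).
  rewrite mx mt /eta /etaP -/gamma; field; rewrite gn0 andTb.
  by rewrite gt_eqF.
have -> : - (((y / gamma) ^+ 2 - (c / gamma) ^+ 2) / 2) = - eta * y ^+ 2 - (- eta * c ^+ 2).
  by rewrite /eta /etaP -/gamma; field.
rewrite expRD expRN => h; have e0 := expR_gt0 (- eta * c ^+ 2).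
rewrite -(ler_pM2l e0) mulrCA mulfV ?mulr1 ?gt_eqF// in h.
Qed.

(** With margins y at z and y - e at u, the left side is 2 y e - e^2 and the gradient term is 2 y e.
    It remains that 2 zeta y^2 <= 1, which holds as |y| <= gamma and zeta <= 1 / (4 gamma^2). *)
Lemma surrogate_curvature g xt z u : norm2 g <= G -> inD B xt -> inD B z ->
  surrogate alpha g xt z - surrogate alpha g xt u
    <= dotp (grad (surrogate alpha g xt) z) (z - u)
       - zeta / 2 * dotp (grad (surrogate alpha g xt) z) (z - u) ^+ 2.
Proof.
move=> gG xtD zD; have yz := margin_le B_ge1 alpha_gt0 gG xtD zD.
rewrite grad_surrogate// dotpZl !surrogateE//.
have diff : margin alpha g xt z - margin alpha g xt u = s * dotp g (z - u).
  by rewrite /margin -/s !dotpBr; ring.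
set y := margin alpha g xt z in yz diff *; set y' := margin alpha g xt u in diff *.
have -> : 2 * y * Num.sqrt (alpha / 2) * dotp g (z - u) = 2 * y * (y - y') by rewrite -/s diff; ring.
have zy : zeta * (y ^+ 2 * 4) <= 1.
  have y2 : y ^+ 2 <= gamma ^+ 2.
    by rewrite -(real_normK (num_real y)) ler_pXn2r ?nnegrE ?(ltW gamma0).
  apply: (@le_trans _ _ (1 / (4 * gamma ^+ 2) * (gamma ^+ 2 * 4))); last first.
    by rewrite le_eqVlt; apply/orP; left; apply/eqP; field; rewrite gt_eqF.
  apply: ler_pM; [exact: ltW zeta_gt0| |exact: zeta_le|by rewrite ler_pM2r].
  by rewrite pmulr_lge0 ?sqr_ge0.
have := ler_wpM2r (sqr_ge0 (y - y')) zy; have := sqr_ge0 (y - y').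
set e := y - y'; have -> : y' = y - e by rewrite /e; ring.
nra.
Qed.

Lemma grad_surrogate_sqr_le g xt z : norm2 g <= G -> inD B xt -> inD B z ->
  dotp (grad (surrogate alpha g xt) z) (grad (surrogate alpha g xt) z)
    <= 2 * gamma ^+ 2 * alpha * G ^+ 2.
Proof.
move=> gG xtD zD; have yz := margin_le B_ge1 alpha_gt0 gG xtD zD.
rewrite grad_surrogate// dotpZl dotpZr -sqr_norm2 -/s.
have s2 : s ^+ 2 = alpha / 2 by rewrite sqr_sqrtr// ltW// divr_gt0.
set y := margin alpha g xt z in yz *.
have -> : 2 * y * s * (2 * y * s * norm2 g ^+ 2) = 2 * alpha * (y ^+ 2 * norm2 g ^+ 2).
  transitivity (4 * s ^+ 2 * (y ^+ 2 * norm2 g ^+ 2)); first by ring.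
  by rewrite s2; field.
have -> : 2 * gamma ^+ 2 * alpha * G ^+ 2 = 2 * alpha * (gamma ^+ 2 * G ^+ 2) by ring.
rewrite ler_pM2l ?mulr_gt0//; apply: ler_pM; rewrite ?sqr_ge0//.
  by rewrite -(real_normK (num_real y)) ler_pXn2r ?nnegrE ?(ltW gamma0).
by rewrite ler_pXn2r ?nnegrE ?norm2_ge0// (le_trans ler01).
Qed.

End SurrogateCurvature.

Lemma ler_term_sum_nat {R : realType} (F : nat -> R) m n j :
  (forall i, (m <= i < n)%N -> 0 <= F i) -> (m <= j < n)%N ->
  F j <= \sum_(m <= i < n) F i.
Proof.
move=> F0 jmn; rewrite (bigD1_seq j) ?iota_uniq ?mem_index_iota//= lerDl.
rewrite big_seq_cond sumr_ge0// => i; rewrite mem_index_iota => /andP[imn _].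
exact: F0.
Qed.

(** * Regret of the meta-algorithm and of one expert *)

Section FLHRegret.
Context {R : realType} {d : nat}.
Variables (B G alpha : R) (loss : nat -> 'rV[R]_d -> R) (init : nat -> 'rV[R]_d) (n : nat).
Hypotheses (B_ge1 : 1 <= B) (G_ge1 : 1 <= G) (alpha_gt0 : 0 < alpha) (d_gt0 : (0 < d)%N).
Hypothesis init_in : forall j, inD B (init j).
Hypothesis gradG : forall t y, (1 <= t <= n)%N -> inD B y -> norm2 (grad (loss t) y) <= G.

Let B_ge0 : 0 <= B. Proof. exact: le_trans ler01 B_ge1. Qed.
Let gamma : R := gammaP d B G alpha.
Let eta : R := etaP d B G alpha.
Let zeta : R := zetaP d B G alpha.
Let eps : R := epsP d B zeta.
Let run := flh_run B G alpha loss init.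
Let x := flh_x B G alpha loss init.
Let f := flh_f B G alpha loss init.
Let L2 : R := 2 * gamma ^+ 2 * alpha * G ^+ 2.

Let eta0 : 0 < eta. Proof. exact: eta_gt0. Qed.
Let zeta0 : 0 < zeta. Proof. exact: zeta_gt0. Qed.
Let gamma0 : 0 < gamma. Proof. exact: gamma_gt0. Qed.

Lemma D0_gt0 : 0 < D0 d B.
Proof. by rewrite !mulr_gt0 ?sqrtr_gt0 ?ltr0n// (lt_le_trans ltr01). Qed.

Lemma eps_gt0 : 0 < eps.
Proof. by rewrite divr_gt0// mulr_gt0// exprn_gt0// D0_gt0. Qed.

(** The normalizer of the exponential weights in round k + 1, which starts from the state
    [run k]. *)
Definition mix k : R :=
  \sum_(1 <= j < k.+2) st_v (run k) j * expR (- eta * f k.+1 (st_z (run k) j)).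

Lemma run_z k j : st_z (run k.+1) j = if (1 <= j <= k.+1)%N
  then ons_z B zeta (st_A (run k) j) (st_z (run k) j) (grad (f k.+1) (st_z (run k) j))
  else st_z (run k) j.
Proof. by []. Qed.

Lemma run_A k j : st_A (run k.+1) j = if (1 <= j <= k.+1)%N
  then ons_A (st_A (run k) j) (grad (f k.+1) (st_z (run k) j))
  else st_A (run k) j.
Proof. by []. Qed.

Lemma run_v k j : st_v (run k.+1) j = if (1 <= j <= k.+1)%N
  then (1 - k.+2%:R^-1) *
       (st_v (run k) j * expR (- eta * f k.+1 (st_z (run k) j)) / mix k)
  else if j == k.+2 then k.+2%:R^-1 else 0.
Proof. by []. Qed.

Lemma run_z_in k j : inD B (st_z (run k) j).
Proof.
elim: k j => [|k IH] j //; rewrite run_z; case: ifP => // _; exact: ons_z_in.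
Qed.

Lemma run_A_posdef k j : posdef (st_A (run k) j).
Proof.
elim: k j => [|k IH] j; first exact/posdef_scalar/eps_gt0.
by rewrite run_A; case: ifP => // _; exact: posdef_ons_A.
Qed.

Lemma run_v_gt0_sum1 k :
  (forall j, (1 <= j <= k.+1)%N -> 0 < st_v (run k) j) /\
  \sum_(1 <= j < k.+2) st_v (run k) j = 1.
Proof.
elim: k => [|k [v0 v1]].
  split; last by rewrite big_nat1.
  by move=> [|[|j]].
have mix0 : 0 < mix k.
  rewrite /mix big_nat_recr//= ltr_wpDl ?mulr_gt0 ?expR_gt0 ?v0 ?leqnn//.
  rewrite big_nat_cond sumr_ge0// => j; rewrite andbT => /andP[j1 jk].
  by rewrite mulr_ge0 ?expR_ge0// ltW// v0// j1 ltnW.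
have k1 : 0 < 1 - k.+2%:R^-1 :> R by rewrite subr_gt0 invf_lt1 ?ltr1n// ltr0n.
split=> [j|].
  rewrite run_v; case: ifP => [jk _|jk /andP[j1 jk2]].
    by rewrite mulr_gt0// divr_gt0// mulr_gt0 ?expR_gt0// v0.
  rewrite (_ : j == k.+2) ?invr_gt0 ?ltr0n// eqn_leq jk2.
  by move: jk; rewrite j1 /= => /negbT; rewrite -ltnNge.
rewrite big_nat_recr// run_v ltnn andbF eqxx.
rewrite (eq_big_nat _ _ (F2 := fun j => (1 - k.+2%:R^-1) *
    (st_v (run k) j * expR (- eta * f k.+1 (st_z (run k) j)) / mix k))); last first.
  by move=> j; rewrite run_v ltnS => ->.
by rewrite -mulr_sumr -mulr_suml -/(mix k) divff ?gt_eqF// mulr1 /= subrK.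
Qed.

Lemma run_v_le1 k j : (1 <= j <= k.+1)%N -> st_v (run k) j <= 1.
Proof.
have [v0 v1] := run_v_gt0_sum1 k => jk; rewrite -[leRHS]v1.
by apply: ler_term_sum_nat => // i ik; exact/ltW/v0.
Qed.

Lemma mix_gt0 k : 0 < mix k.
Proof.
have [v0 _] := run_v_gt0_sum1 k.
rewrite /mix big_nat_recr//= ltr_wpDl ?mulr_gt0 ?expR_gt0 ?v0 ?leqnn//.
rewrite big_nat_cond sumr_ge0// => j; rewrite andbT => /andP[j1 jk].
by rewrite mulr_ge0 ?expR_ge0// ltW// v0// j1 ltnW.
Qed.

Lemma flh_x_in t : (0 < t)%N -> inD B (x t).
Proof.
case: t => // k _; have [v0 v1] := run_v_gt0_sum1 k.
by apply: inD_convex_sum => // j /v0/ltW; split => //; exact: run_z_in.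
Qed.

Let gG k : (k < n)%N -> norm2 (grad (loss k.+1) (x k.+1)) <= G.
Proof. by move=> kn; apply: gradG => //; exact: flh_x_in. Qed.

(** Bound every exponential by its tangent at the prediction. The prediction is the weighted mean of
    the experts, so the linear terms cancel. *)
Lemma mix_le k : (k < n)%N -> mix k <= expR (- eta * f k.+1 (x k.+1)).
Proof.
move=> kn; have [v0 v1] := run_v_gt0_sum1 k; have xD : inD B (x k.+1) by exact: flh_x_in.
set gt := grad (loss k.+1) (x k.+1).
apply: (@le_trans _ _ (\sum_(1 <= j < k.+2) st_v (run k) j *
    (expR (- eta * f k.+1 (x k.+1)) * (1 - eta * dotp gt (st_z (run k) j - x k.+1))))).
  rewrite /mix [leLHS]big_nat_cond [leRHS]big_nat_cond; apply: ler_sum => j; rewrite andbT ltnS => /v0/ltW vj.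
  by apply: ler_wpM2l => //; apply: surrogate_exp_tangent => //; [exact: gG|exact: run_z_in].
have -> : \sum_(1 <= j < k.+2) st_v (run k) j *
    (expR (- eta * f k.+1 (x k.+1)) * (1 - eta * dotp gt (st_z (run k) j - x k.+1)))
  = expR (- eta * f k.+1 (x k.+1)) * (\sum_(1 <= j < k.+2) st_v (run k) j
      - eta * (\sum_(1 <= j < k.+2) dotp gt (st_v (run k) j *: st_z (run k) j)
             - (\sum_(1 <= j < k.+2) st_v (run k) j) * dotp gt (x k.+1))).
  rewrite mulr_suml -sumrB mulr_sumr -sumrB mulr_sumr; apply: eq_bigr => j _.
  by rewrite dotpBr dotpZr; ring.
rewrite -dotp_sumr v1 mul1r.
have -> : \sum_(1 <= j < k.+2) st_v (run k) j *: st_z (run k) j = x k.+1 by [].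
by rewrite subrr mulr0 subr0 mulr1.
Qed.

Lemma expert_start r k : (k <= r)%N ->
  st_z (run k) r.+1 = init r.+1 /\ st_A (run k) r.+1 = eps%:M.
Proof.
elim: k => [//|k IH] kr; have [zE AE] := IH (ltnW kr).
by rewrite run_z run_A zE AE /= ltnNge kr.
Qed.

Lemma expert_start_v r : st_v (run r) r.+1 = r.+1%:R^-1.
Proof. by case: r => [|r]; rewrite ?invr1// run_v ltnn andbF eqxx. Qed.

(** Induction over the rounds since the expert's start. The logarithm of its weight times the round
    index accumulates the meta regret, from ln 1 = 0 at the start; [ons_potential] telescopes the
    expert's own regret. *)
Lemma expert_regret r m u : (r + m <= n)%N -> inD B u ->
  \sum_(r.+1 <= t < (r + m).+1) (f t (x t) - f t u)
    <= eta^-1 * ln ((r + m).+1%:R * st_v (run (r + m)) r.+1)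
       + (ons_potential zeta u eps%:M (init r.+1)
       - ons_potential zeta u (st_A (run (r + m)) r.+1) (st_z (run (r + m)) r.+1)) /\
  entry_sum (st_A (run (r + m)) r.+1) <= d%:R * (eps + m%:R * L2).
Proof.
elim: m => [|m IH] rmn uD.
  have [zE AE] := expert_start (leqnn r).
  rewrite addn0 big_geq// zE AE expert_start_v mulfV ?pnatr_eq0// ln1 mulr0 add0r subrr.
  by rewrite mul0r addr0 entry_sum_scalar ?(ltW eps_gt0)//; split.
rewrite addnS in rmn *; have [reg esum] := IH (ltnW rmn) uD.
set k := (r + m)%N in rmn reg esum *.
have rk : (1 <= r.+1 <= k.+1)%N by rewrite /= ltnS leq_addr.
have [v0 v1] := run_v_gt0_sum1 k; have {v0} vr := v0 _ rk.
have xD : inD B (x k.+1) by exact: flh_x_in.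
have zD := run_z_in k r.+1; have Ap := run_A_posdef k r.+1.
rewrite run_A run_z run_v rk big_nat_recr; last by rewrite ltnS leq_addr.
set z := st_z (run k) r.+1 in zD reg *; set A := st_A (run k) r.+1 in Ap reg esum *.
set v := st_v (run k) r.+1 in vr reg *.
split; last first.
  apply: le_trans (entry_sum_rank1 _ _) _.
  have gl := grad_surrogate_sqr_le B_ge1 G_ge1 alpha_gt0 (gG rmn) xD zD.
  rewrite -natr1 mulrDl mul1r addrA [leRHS]mulrDr; apply: lerD => //.
  by apply: ler_wpM2l => //; exact: gl.
have curv : f k.+1 z - f k.+1 u <= dotp (grad (f k.+1) z) (z - u)
    - zeta / 2 * dotp (grad (f k.+1) z) (z - u) ^+ 2 :=
  surrogate_curvature B_ge1 G_ge1 alpha_gt0 d_gt0 u (gG rmn) xD zD.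
have step := ons_step_regret B_ge0 zeta0 z (grad (f k.+1) z) Ap uD.
(* The factor k + 2 turns the share 1 - 1 / (k + 2) kept by old experts into k + 1, so fixed-share
   mixing costs nothing here. *)
have meta : eta^-1 * ln (k.+1%:R * v) + (f k.+1 (x k.+1) - f k.+1 z)
    <= eta^-1 * ln (k.+2%:R * ((1 - k.+2%:R^-1) * (v * expR (- eta * f k.+1 z) / mix k))).
  have kv : 0 < k.+1%:R * v by rewrite mulr_gt0// ltr0n.
  have -> : k.+2%:R * ((1 - k.+2%:R^-1) * (v * expR (- eta * f k.+1 z) / mix k))
      = k.+1%:R * v * (expR (- eta * f k.+1 z) / mix k).
    have -> : k.+1%:R = k.+2%:R - 1 :> R by rewrite -(natr1 k.+1) addrK.
    have K2 : k.+2%:R != 0 :> R by rewrite pnatr_eq0.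
    by move: k.+2%:R K2 => K K0; field; rewrite K0 gt_eqF// mix_gt0.
  have em : 0 < expR (- eta * f k.+1 z) / mix k by rewrite divr_gt0 ?expR_gt0 ?mix_gt0.
  rewrite [in leRHS]lnM ?posrE// mulrDr lerD2l -(ler_pM2l eta0) mulrA mulfV ?gt_eqF// mul1r.
  rewrite ln_div ?posrE ?expR_gt0 ?mix_gt0// expRK.
  have : ln (mix k) <= - eta * f k.+1 (x k.+1).
    by rewrite -[leRHS]expRK ler_ln ?posrE ?expR_gt0 ?mix_gt0// mix_le.
  lra.
rewrite /=; lra.
Qed.
End FLHRegret.

(** * Static regret on every interval *)

Section StaticRegret.
Context {R : realType} {d : nat}.
Variables (B G alpha : R) (loss : nat -> 'rV[R]_d -> R) (init : nat -> 'rV[R]_d) (n : nat).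
Hypotheses (B_ge1 : 1 <= B) (G_ge1 : 1 <= G) (alpha_gt0 : 0 < alpha) (d_gt0 : (0 < d)%N).
Hypothesis init_in : forall j, inD B (init j).
Hypothesis gradG : forall t y, (1 <= t <= n)%N -> inD B y -> norm2 (grad (loss t) y) <= G.

Let gamma : R := gammaP d B G alpha.
Let zeta : R := zetaP d B G alpha.
Let eps : R := epsP d B zeta.
Let x := flh_x B G alpha loss init.
Let f := flh_f B G alpha loss init.
Let W : R := 8 * G ^+ 2 * B ^+ 2 * alpha * d%:R + 1 / alpha.

Let B_gt0 : 0 < B. Proof. exact: lt_le_trans ltr01 B_ge1. Qed.
Let G_gt0 : 0 < G. Proof. exact: lt_le_trans ltr01 G_ge1. Qed.
Let dR_ge1 : 1 <= d%:R :> R. Proof. by rewrite ler1n. Qed.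
Let gamma0 : 0 < gamma. Proof. exact: gamma_gt0. Qed.
Let zeta0 : 0 < zeta. Proof. exact: zeta_gt0. Qed.
Let GBad0 : 0 <= G ^+ 2 * B ^+ 2 * alpha * d%:R.
Proof. by rewrite mulr_ge0// mulr_ge0 ?(ltW alpha_gt0)// mulr_ge0 ?sqr_ge0. Qed.

Lemma gamma_sqr_le_W : gamma ^+ 2 <= W.
Proof. by have := gamma_sqr_le (d := d) B G alpha_gt0; have := GBad0; rewrite /W -/gamma; lra. Qed.

(** The inverse is 16 G B sqrt d or 4 gamma^2. The former is at most 8 W, since 2 y <= alpha y^2 + 1
    / alpha at y = G B sqrt d. *)
Lemma invr_zeta_le : zeta^-1 <= 12 * W.
Proof.
have sd0 : 0 < Num.sqrt d%:R :> R by rewrite sqrtr_gt0 ltr0n.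
have g2 := gamma_sqr_le_W.
have GBd : 2 * (G * B * Num.sqrt d%:R) <= W.
  have := sqr_ge0 (alpha * (G * B * Num.sqrt d%:R) - 1).
  rewrite sqrrB mulr1 expr1n; set y := G * B * _.
  have y2 : y ^+ 2 = G ^+ 2 * B ^+ 2 * d%:R by rewrite /y !exprMn sqr_sqrtr ?ler0n.
  rewrite exprMn y2 => h.
  rewrite -(ler_pM2l alpha_gt0) /W mulrDr mulrCA -/y div1r mulfV ?gt_eqF//.
  have := mulr_ge0 (ltW alpha_gt0) GBad0; lra.
have W0 : 0 < W by apply: lt_le_trans g2; rewrite exprn_gt0.
rewrite /zeta /zetaP minEle -/gamma; case: ifP => _; rewrite div1r invrK; last by lra.
by rewrite -!mulrA; rewrite -!mulrA in GBd; lra.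
Qed.

(** Squared gradients are thus at most [eps], so n updates multiply the scale of the matrix by at
    most n + 1 and [ln eps] cancels from the log-determinant difference. With Q = G^2 B^2 alpha d,
    the ratio of the two sides is at most Q / (2 gamma^2), and 2 Q <= gamma^2. *)
Lemma grad_bound_le_eps : 2 * gamma ^+ 2 * alpha * G ^+ 2 <= eps.
Proof.
have g2 := gamma_sqr_ge (d := d) B_ge1 G_ge1 alpha_gt0; rewrite -/gamma in g2.
have D0E : D0 d B ^+ 2 = 4 * B ^+ 2 * d%:R.
  by rewrite /D0 !exprMn sqr_sqrtr ?ler0n//; ring.
have D0p : 0 < D0 d B ^+ 2 by rewrite exprn_gt0// D0_gt0.
have zD0 : 0 < zeta ^+ 2 * D0 d B ^+ 2 by apply: mulr_gt0 D0p; exact: exprn_gt0.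
rewrite /eps /epsP ler_pdivlMr// D0E.
have gp : 0 < gamma ^+ 2 by rewrite exprn_gt0.
have z2 : zeta ^+ 2 <= (1 / (4 * gamma ^+ 2)) ^+ 2.
  have zl : zeta <= 1 / (4 * gamma ^+ 2) := zeta_le B G alpha.
  by rewrite ler_pXn2r ?nnegrE ?(ltW zeta0)// (le_trans (ltW zeta0) zl).
have Q0 := GBad0; set Q := G ^+ 2 * B ^+ 2 * alpha * d%:R in Q0.
have -> : 2 * gamma ^+ 2 * alpha * G ^+ 2 * (zeta ^+ 2 * (4 * B ^+ 2 * d%:R))
  = 8 * gamma ^+ 2 * Q * zeta ^+ 2 by rewrite /Q; ring.
apply: (@le_trans _ _ (8 * gamma ^+ 2 * Q * (1 / (4 * gamma ^+ 2)) ^+ 2)).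
  by apply: ler_wpM2l z2; rewrite mulr_ge0// mulr_ge0// ltW.
have -> : 8 * gamma ^+ 2 * Q * (1 / (4 * gamma ^+ 2)) ^+ 2 = Q / (2 * gamma ^+ 2).
  by field; rewrite gt_eqF.
rewrite ler_pdivrMr ?mulr_gt0// mul1r.
have : 2 * Q <= gamma ^+ 2 by move: g2; rewrite /Q; lra.
lra.
Qed.

(** n + 1 <= 2 n and ln 2 <= 1. *)
Lemma ln_succ_le m : (0 < n)%N -> (m <= n.+1)%N -> ln (m%:R : R) <= 1 + ln n%:R.
Proof.
move=> n0; case: m => [|m] mn.
  by apply: (@le_trans _ _ 0); rewrite ?ln_le0 ?addr_ge0 ?ln_ge0 ?ler1n.
have n0R : 0 < n%:R :> R by rewrite ltr0n.
apply: (@le_trans _ _ (ln (2 * n%:R))).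
  rewrite ler_ln ?posrE ?ltr0n ?mulr_gt0// -natrM ler_nat; lia.
rewrite lnM ?posrE// lerD2r (_ : 2 = 1 + 1 :> R); last by lra.
by apply: le_ln1Dx; lra.
Qed.

(** Up to the factor d W (1 + ln n), the meta-algorithm contributes 2, from eta^-1 = 2 gamma^2. The
    initial distance and the log-determinant each contribute half of zeta^-1 <= 12 W, hence 12
    together. *)
Lemma static_regret r s u : (1 <= r)%N -> (r <= s <= n)%N -> inD B u ->
  \sum_(r <= t < s.+1) (f t (x t) - f t u) <= 14 * d%:R * W * (1 + ln n%:R).
Proof.
case: r => // r _ /andP[rs sn] uD; have n0 : (0 < n)%N by lia.
have rsE : (r + (s - r) = s)%N by lia.
have := @expert_regret R d B G alpha loss init n B_ge1 G_ge1 alpha_gt0 d_gt0 init_in gradG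
  r (s - r) u; rewrite rsE => /(_ sn uD)[].
rewrite -/f -/x -/zeta -/eps -/gamma.
have [v0 _] := run_v_gt0_sum1 B G alpha loss init s.
have z0 := zeta0; have g2 := gamma_sqr_le_W.
have Ap := run_A_posdef loss init B_ge1 G_ge1 alpha_gt0 d_gt0 s r.+1.
set v := st_v _ r.+1; set A := st_A _ r.+1 in Ap *; set z := st_z _ r.+1.
have rs' : (1 <= r.+1 <= s.+1)%N by rewrite /= ltnW.
have vp : 0 < v by exact: v0.
have vle : v <= 1 by exact: run_v_le1.
have lnv : ln (s.+1%:R * v) <= 1 + ln n%:R.
  apply: le_trans (ln_succ_le n0 (m := s.+1) _); last by rewrite ltnS.
  by rewrite ler_ln ?posrE ?mulr_gt0 ?ltr0n// ger_pMr ?ltr0n.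
have ln0 : 0 <= ln n%:R :> R by rewrite ln_ge0// ler1n.
move=> reg esum; apply: le_trans reg _.
have [As A0 dA] := Ap.
have eps0 : 0 < eps by exact: eps_gt0.
have lnA : ln (\det A) <= d%:R * (1 + ln n%:R + ln eps).
  have nep : 0 < n.+1%:R * eps by apply: mulr_gt0; rewrite ?ltr0n.
  apply: (@le_trans _ _ (ln ((n.+1%:R * eps) ^+ d))).
    rewrite ler_ln ?posrE ?exprn_gt0//.
    apply: le_trans (det_le_entry_sum _ d_gt0) _.
    have e0 : 0 <= entry_sum A by do 2![apply: sumr_ge0 => ? _].
    have ne0 := ltW nep.
    have ed0 : 0 <= entry_sum A / d%:R by exact: divr_ge0.
    rewrite lerXn2r ?nnegrE//.
    rewrite ler_pdivrMr ?ltr0n// mulrC; apply: le_trans esum _.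
    have -> : n.+1%:R * eps = eps + n%:R * eps by rewrite -natr1 mulrDl mul1r addrC.
    rewrite ler_pM2l ?ltr0n// lerD2l.
    apply: (@le_trans _ _ ((s - r)%:R * eps)).
      by apply: ler_wpM2l => //; exact: grad_bound_le_eps.
    by rewrite ler_pM2r// ler_nat (leq_trans (leq_subr _ _) sn).
  rewrite lnXn// -[leLHS]mulr_natl ler_pM2l ?ltr0n//.
  by rewrite lnM ?posrE ?ltr0n// lerD2r ln_succ_le.
have lneps : ln (\det (eps%:M : 'M[R]_d)) = d%:R * ln eps.
  by rewrite det_scalar lnXn// mulr_natl.
(* [eps] is chosen so that eps D0^2 = zeta^-2, where D0 is the Euclidean diameter of the box. *)
have dist : zeta / 2 * quadf eps%:M (init r.+1 - u) <= (2 * zeta)^-1.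
  have D0p : 0 < D0 d B by exact: D0_gt0.
  have nb : dotp (init r.+1 - u) (init r.+1 - u) <= D0 d B ^+ 2.
    rewrite -sqr_norm2 ler_pXn2r ?nnegrE ?norm2_ge0 ?(ltW D0p)//.
    by apply: norm2_sub_le => //; exact: ltW.
  have -> : (2 * zeta)^-1 = zeta / 2 * (eps * D0 d B ^+ 2).
    by rewrite /eps /epsP; field; rewrite !gt_eqF.
  rewrite quadf_scalar; apply: ler_wpM2l; first by rewrite divr_ge0// ltW.
  by apply: ler_wpM2l => //; exact: ltW.
have q0 : 0 <= zeta / 2 * quadf A (z - u) by rewrite mulr_ge0 ?divr_ge0// ltW.
have zi0 : 0 < zeta^-1 by rewrite invr_gt0.
have lnA' : zeta^-1 * (ln (\det A) - d%:R * ln eps) <= zeta^-1 * (d%:R * (1 + ln n%:R)).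
  by rewrite ler_pM2l//; lra.
rewrite /ons_potential lneps.
have -> : (etaP d B G alpha)^-1 = 2 * gamma ^+ 2.
  by rewrite /etaP -/gamma div1r invrK.
have z2 : (2 * zeta)^-1 = zeta^-1 / 2 by rewrite invfM mulrC.
rewrite z2 in dist *.
have meta : 2 * gamma ^+ 2 * ln (s.+1%:R * v) <= 2 * W * (d%:R * (1 + ln n%:R)).
  apply: (@le_trans _ _ (2 * gamma ^+ 2 * (1 + ln n%:R))).
    by rewrite ler_pM2l// mulr_gt0// exprn_gt0.
  have gg := sqr_ge0 gamma; apply: ler_pM; [lra|lra|lra|].
  by apply: ler_peMl => //; lra.
have zW := invr_zeta_le.
have dl : 1 <= d%:R * (1 + ln n%:R) :> R.
  apply: le_trans dR_ge1 _; rewrite ler_peMr//; lra.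
have zdl : zeta^-1 <= zeta^-1 * (d%:R * (1 + ln n%:R)) by rewrite ler_peMr// ltW.
have zWdl : zeta^-1 * (d%:R * (1 + ln n%:R)) <= 12 * W * (d%:R * (1 + ln n%:R)).
  by apply: ler_wpM2r zW; lra.
have -> : 14 * d%:R * W * (1 + ln n%:R) = 14 * W * (d%:R * (1 + ln n%:R)) by ring.
lra.
Qed.

End StaticRegret.

(** * Dynamic regret of FLH-ONS *)

Section DynamicRegret.
Context {R : realType} {d : nat}.
Variables (B G alpha : R) (loss : nat -> 'rV[R]_d -> R) (init : nat -> 'rV[R]_d) (n : nat).
Hypotheses (B_ge1 : 1 <= B) (G_ge1 : 1 <= G) (alpha_gt0 : 0 < alpha) (d_gt0 : (0 < d)%N).
Hypothesis n_gt0 : (0 < n)%N.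
Hypothesis init_in : forall j, inD B (init j).
Hypothesis gradG : forall t y, (1 <= t <= n)%N -> inD B y -> norm2 (grad (loss t) y) <= G.

Let x := flh_x B G alpha loss init.
Let f := flh_f B G alpha loss init.
Let W : R := 8 * G ^+ 2 * B ^+ 2 * alpha * d%:R + 1 / alpha.
Let S : R := 14 * d%:R * W * (1 + ln n%:R).

Let B_gt0 : 0 < B. Proof. exact: lt_le_trans ltr01 B_ge1. Qed.
Let G_gt0 : 0 < G. Proof. exact: lt_le_trans ltr01 G_ge1. Qed.
Let dR_ge1 : 1 <= d%:R :> R. Proof. by rewrite ler1n. Qed.
Let ln_ge0n : 0 <= ln n%:R :> R. Proof. by rewrite ln_ge0// ler1n. Qed.

Let x_in t : (0 < t)%N -> inD B (x t).
Proof. exact: flh_x_in. Qed.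

Lemma regret_gain t w : f t (x t) - f t w
  = dotp (grad (loss t) (x t)) (x t - w) - alpha / 2 * dotp (grad (loss t) (x t)) (x t - w) ^+ 2.
Proof. exact: surrogate_gain. Qed.

Lemma alphaG_le_W : 8 * (alpha * G ^+ 2 * B ^+ 2 * d%:R) <= W.
Proof.
have : 0 < 1 / alpha by rewrite divr_gt0.
rewrite /W; set p := 1 / alpha; lra.
Qed.

Lemma alphaG_le : alpha * G ^+ 2 <= alpha * G ^+ 2 * B ^+ 2 * d%:R.
Proof.
have ag : 0 <= alpha * G ^+ 2 by rewrite mulr_ge0 ?sqr_ge0// ltW.
have B2 : 1 <= B ^+ 2 by rewrite expr_ge1// ltW.
apply: le_trans (ler_peMr _ dR_ge1); first exact: ler_peMr.
by rewrite mulr_ge0// (le_trans ler01).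
Qed.

Lemma W_gt0 : 0 < W.
Proof.
have ag : 0 < alpha * G ^+ 2 by rewrite mulr_gt0// exprn_gt0.
by have := alphaG_le; have := alphaG_le_W; lra.
Qed.

Lemma W_le_S : W <= S.
Proof.
have W0 := W_gt0; rewrite /S.
have dW : W <= d%:R * W by rewrite ler_peMl// ltW.
have : d%:R * W <= d%:R * W * (1 + ln n%:R) by rewrite ler_peMr ?lerDl// (le_trans (ltW W0)).
lra.
Qed.

Lemma flh_dynamic_regret (w : nat -> 'rV[R]_d) :
  (forall t, (1 <= t <= n)%N -> inD B (w t)) ->
  \sum_(1 <= t < n.+1) (f t (x t) - f t (w t))
    <= (1 + d%:R) * S + 3 * cbrt (n%:R * d%:R) * (2 * S + alpha * G ^+ 2)
         * cbrt (\sum_(2 <= t < n.+1) norm1 (w t - w t.-1)) ^+ 2.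
Proof.
(* Rounds 1..n are renumbered 0..N; the variation, summed from round 2, becomes [TV N]. *)
move=> wD; pose N := n.-1; have nE : n = N.+1 by rewrite prednK.
pose g t := grad (loss t.+1) (x t.+1).
have gG t : (t < N.+1)%N -> norm2 (g t) <= G.
  by rewrite -nE => tn; apply: gradG => //; exact: x_in.
have st r s u : (r <= s <= N)%N -> inD B u ->
    \sum_(r <= t < s.+1) gain alpha g (fun t => x t.+1) t u <= S.
  move=> /andP[rs sN] uD.
  have := @static_regret _ _ _ _ _ loss _ n B_ge1 G_ge1 alpha_gt0 d_gt0 init_in gradG
    r.+1 s.+1 u isT.
  rewrite ltnS rs nE ltnS sN -nE => /(_ isT uD); rewrite big_add1 /=.
  apply: le_trans; rewrite le_eqVlt; apply/orP; left; apply/eqP; apply: eq_bigr => t _.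
  exact/esym/regret_gain.
have S0 : 0 <= S := le_trans (ltW W_gt0) W_le_S.
have vD t : (t <= N)%N -> inD B (w t.+1) by move=> tN; apply: wD; rewrite nE.
have := dynamic_gain_le B_ge1 alpha_gt0 d_gt0 gG st S0 vD.
have -> : TV N (fun t => w t.+1) = \sum_(2 <= t < n.+1) norm1 (w t - w t.-1).
  by rewrite nE !big_add1 /= big_mkord.
rewrite -nE; apply: le_trans; rewrite le_eqVlt; apply/orP; left; apply/eqP.
rewrite big_add1 /= nE big_mkord; apply: eq_bigr => t _.
exact: regret_gain.
Qed.

Lemma norm1_path_le (w : nat -> 'rV[R]_d) t : (1 <= t <= n)%N ->
  norm1 (w t - w 1%N) <= \sum_(2 <= t < n.+1) norm1 (w t - w t.-1).
Proof.
move=> /andP[t1 tn]; apply: (@le_trans _ _ (\sum_(2 <= s < t.+1) norm1 (w s - w s.-1))).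
  case: t t1 tn => // t _; elim: t => [|t IH] tn.
    by rewrite subrr big_geq// /norm1 big1// => i _; rewrite mxE normr0.
  rewrite big_nat_recr//= (_ : w t.+2 - w 1%N = (w t.+1 - w 1%N) + (w t.+2 - w t.+1)).
    by apply: le_trans (le_norm1D _ _) _; rewrite lerD2r IH// ltnW.
  by rewrite [RHS]addrC addrA subrK.
rewrite [leRHS](big_cat_nat (n := t.+1))//= lerDl.
by apply: sumr_ge0 => i _; exact: norm1_ge0.
Qed.

(** All w_t are within 1 / n of w_1, so the static bound against w_1 changes by O(1 / n) per round,
    and by at most W in total. *)
Lemma flh_small_path_regret (w : nat -> 'rV[R]_d) :
  (forall t, (1 <= t <= n)%N -> inD B (w t)) ->
  \sum_(2 <= t < n.+1) norm1 (w t - w t.-1) <= n%:R^-1 ->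
  \sum_(1 <= t < n.+1) (f t (x t) - f t (w t)) <= S + W.
Proof.
move=> wD Vn; have w1D : inD B (w 1%N) by apply: wD; rewrite n_gt0.
have nR : 0 < n%:R :> R by rewrite ltr0n.
have a0 := ltW alpha_gt0; have G0 := ltW G_gt0; have B0 := ltW B_gt0.
have st := @static_regret _ _ _ _ _ loss _ n B_ge1 G_ge1 alpha_gt0 d_gt0 init_in gradG
    1 n (w 1%N) isT.
rewrite n_gt0 leqnn in st; have {}st := st isT w1D.
pose sd : R := Num.sqrt d%:R.
have sd1 : 1 <= sd by rewrite -sqrtr1 ler_wsqrtr.
have sdd : sd ^+ 2 = d%:R by rewrite sqr_sqrtr ?ler0n.
(* G / n bounds the change of the linear term; the bracket bounds the factor 1 - (alpha / 2)(a + b)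
   from the difference of the quadratics, as |a| and |b| are at most 2 G B sqrt d. *)
pose E : R := G / n%:R * (1 + 2 * alpha * G * B * sd).
suff perround t : (1 <= t <= n)%N -> f t (x t) - f t (w t) <= f t (x t) - f t (w 1%N) + E.
  apply: (@le_trans _ _ (\sum_(1 <= t < n.+1) (f t (x t) - f t (w 1%N) + E))).
    rewrite [leLHS]big_nat_cond [leRHS]big_nat_cond; apply: ler_sum => t.
    by rewrite andbT ltnS => /perround.
  rewrite big_split /= sumr_const_nat subn1 /= -[E *+ n]mulr_natl; apply: lerD => //.
  have -> : n%:R * E = G + 2 * (alpha * G ^+ 2 * B * sd) by rewrite /E; field; rewrite gt_eqF.
  have GW : 2 * G <= W.
    have i0 : 0 < alpha^-1 by rewrite invr_gt0.
    have am : 2 * G <= alpha * G ^+ 2 + alpha^-1.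
      rewrite -(ler_pM2l alpha_gt0) mulrDr mulfV ?gt_eqF//.
      by have := sqr_ge0 (alpha * G - 1); rewrite sqrrB mulr1 expr1n; nra.
    have := alphaG_le; have ag := mulr_ge0 a0 (sqr_ge0 G).
    by rewrite /W div1r; set q := alpha^-1 in i0 am *; lra.
  have Bsd : alpha * G ^+ 2 * B * sd <= alpha * G ^+ 2 * B ^+ 2 * d%:R.
    rewrite -!(mulrA (alpha * G ^+ 2)); apply: ler_wpM2l; first by rewrite mulr_ge0 ?sqr_ge0.
    rewrite -sdd; apply: ler_pM; rewrite ?(le_trans ler01 sd1)//.
      by rewrite ler_eXnr.
    by rewrite ler_eXnr.
  have := alphaG_le_W; have W0 := W_gt0; lra.
move=> tn; rewrite !regret_gain.
have gtG : norm2 (grad (loss t) (x t)) <= G by apply: gradG => //; apply: x_in; case/andP: tn.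
have xtD : inD B (x t) by apply: x_in; case/andP: tn.
set gt := grad (loss t) (x t) in gtG *.
have dl u : inD B u -> `|dotp gt (x t - u)| <= 2 * G * B * sd.
  move=> uD; apply: le_trans (norm_dotp_le _ _) _.
  have -> : 2 * G * B * sd = G * (2 * B * sd) by ring.
  by apply: ler_pM; rewrite ?norm2_ge0// norm2_sub_le.
have := dl _ (wD _ tn); have := dl _ w1D.
have diff : `|dotp gt (x t - w t) - dotp gt (x t - w 1%N)| <= G / n%:R.
  rewrite -dotpBr (_ : x t - w t - (x t - w 1%N) = - (w t - w 1%N)); last first.
    by rewrite opprB addrC addrA subrK opprB.
  apply: le_trans (norm_dotp_le _ _) _; apply: ler_pM; rewrite ?norm2_ge0//.
  apply: le_trans (norm2_le_norm1 _) _; rewrite norm1N.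
  exact: le_trans (norm1_path_le w tn) Vn.
move: diff; set b := dotp gt (x t - w t); set a := dotp gt (x t - w 1%N) => ba ha hb.
have -> : b - alpha / 2 * b ^+ 2 = a - alpha / 2 * a ^+ 2
    + (b - a) * (1 - alpha / 2 * (a + b)) by field.
rewrite lerD2l; apply: le_trans (ler_norm _) _; rewrite normrM /E.
apply: ler_pM => //; apply: le_trans (ler_normB _ _) _; rewrite normr1 lerD2l normrM.
rewrite ger0_norm ?divr_ge0//.
have -> : 2 * alpha * G * B * sd = alpha / 2 * (2 * G * B * sd + 2 * G * B * sd) by field.
apply: ler_wpM2l; first by rewrite divr_ge0.
by apply: le_trans (ler_normD _ _) _; exact: lerD.
Qed.

End DynamicRegret.

Theorem theorem3 :
  exists c k : nat,
  forall (R : realType) (d n : nat) (B G Ginf alpha C : R)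
         (loss : nat -> 'rV[R]_d -> R) (init : nat -> 'rV[R]_d),
    (0 < d)%N -> (0 < n)%N ->
    0 < alpha -> 1 <= G -> 1 <= Ginf -> 1 <= B ->
    (forall j, inD B (init j)) ->
    (forall t, (1 <= t <= n)%N ->
       (forall x, inD B x -> differentiable (loss t) x) /\
       convex_on_D B (loss t) /\
       assumptionB1 B alpha (loss t) /\
       assumptionB2 B G Ginf (loss t)) ->
    let x := flh_x B G alpha loss init in
    let f := flh_f B G alpha loss init in
    let dR := d%:R in
    (dyn_regret B n C loss x <= dyn_regret B n C f x)%E /\
    (dyn_regret B n C f x <=
      (c%:R * (1 + ln n%:R) ^+ k *
        (140 * dR ^+ 2 * (8 * G ^+ 2 * B ^+ 2 * alpha * dR + G ^+ 2 * B ^+ 2 + 1 / alpha)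
           * Num.max (n%:R `^ (3%:R^-1) * C `^ (2%:R / 3%:R)) 1
           * indicb R (n%:R^-1 < C)
         + dR * (8 * G ^+ 2 * B ^+ 2 * alpha * dR + 1 / alpha)
           * indicb R (C <= n%:R^-1)))%:E)%E.
Proof.
(* The small-path case needs 15: 14 from the static regret and 1 from the drift of the comparator.
   The other case fits easily under 16 * 140. *)
exists 16%N, 1%N => R d n B G Ginf alpha C loss init d0 n0 a0 G1 _ B1 iD hloss x f dR.
have gradG t y : (1 <= t <= n)%N -> inD B y -> norm2 (grad (loss t) y) <= G.
  by move=> /hloss[_ [_ [_ B2]]] /B2[].
have x_in t : (0 < t)%N -> inD B (x t) by exact: flh_x_in.
split.
  (* The comparison holds round by round: B1 at x_t and w_t bounds the loss regret by the surrogate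
     regret. *)
  apply: ge_ereal_sup => _ [w [wD wC] <-].
  apply: (@le_trans _ _ (\sum_(1 <= t < n.+1) (f t (x t) - f t (w t)))%:E); last first.
    by apply: ereal_sup_ubound; exists w.
  rewrite lee_fin [leLHS]big_nat_cond [leRHS]big_nat_cond; apply: ler_sum => t.
  rewrite andbT ltnS => tn; have [_ [_ [b1 _]]] := hloss t tn.
  have xtD : inD B (x t) by apply: x_in; case/andP: tn.
  have := b1 _ _ xtD (wD t tn); rewrite regret_gain// -/x -(opprB (w t)) dotpNr sqrrN.
  by set p := dotp _ _; set p2 := p ^+ 2; lra.
apply: ge_ereal_sup => _ [w [wD wC] <-]; rewrite lee_fin expr1.
have ln0 : 0 <= ln n%:R :> R by rewrite ln_ge0// ler1n.
have W0 := @W_gt0 R d B G alpha B1 G1 a0 d0.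
have WS := @W_le_S R d B G alpha n B1 G1 a0 d0 n0.
have aGW := @alphaG_le_W R d B G alpha a0.
have aG := @alphaG_le R d B G alpha B1 a0 d0.
have d1 : 1 <= d%:R :> R by rewrite ler1n.
rewrite /dR; set W := 8 * G ^+ 2 * _ * _ * _ + 1 / alpha in W0 WS aGW *.
set S := 14 * d%:R * W * (1 + ln n%:R) in WS *.
rewrite /indicb; case: (leP C n%:R^-1) => Cn; rewrite ?mulr0 ?mulr1 ?add0r ?addr0.
  have := flh_small_path_regret B1 G1 a0 d0 n0 iD gradG wD (le_trans wC Cn).
  move/le_trans; apply.
  rewrite -/W -/S; apply: (@le_trans _ _ (S + d%:R * W * (1 + ln n%:R))).
    have dW : W <= d%:R * W by rewrite ler_peMl// ltW.
    by rewrite lerD2l; apply: le_trans dW _; rewrite ler_peMr ?lerDl// mulr_ge0// ltW.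
  have : 0 <= d%:R * W * (1 + ln n%:R) by apply: mulr_ge0; [apply: mulr_ge0 => //; exact: ltW|exact: addr_ge0].
  rewrite /S; lra.
have nR : 0 < n%:R :> R by rewrite ltr0n.
have C0 : 0 < C by apply: lt_trans Cn; rewrite invr_gt0.
have := flh_dynamic_regret B1 G1 a0 d0 n0 iD gradG wD.
rewrite -/W -/S => /le_trans; apply.
set V := \sum_(2 <= t < n.+1) _ in wC *.
have V0 : 0 <= V by apply: sumr_ge0 => t _; exact: norm1_ge0.
have CE : C `^ (2%:R / 3%:R) = cbrt C ^+ 2.
  by rewrite mulrC powRrM powR_mulrn ?powR_ge0.
have VC : cbrt V ^+ 2 <= cbrt C ^+ 2.
  by rewrite ler_pXn2r ?nnegrE ?cbrt_ge0// ler_cbrt.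
rewrite CE -/(cbrt n%:R); set X := Num.max _ 1.
have X1 : 1 <= X by rewrite le_max lexx orbT.
have S0 : 0 < S by exact: lt_le_trans W0 WS.
(* The cube root of d is bounded by d, which leaves n^(1/3) C^(2/3). *)
have nX : cbrt (n%:R * d%:R) * cbrt V ^+ 2 <= d%:R * X.
  rewrite cbrtM// -mulrA mulrCA; apply: ler_pM; rewrite ?cbrt_ge0 ?cbrt_le_self//.
    by rewrite mulr_ge0 ?cbrt_ge0 ?sqr_ge0.
  by rewrite le_max ler_wpM2l ?cbrt_ge0.
have dSX : d%:R * S <= d%:R * S * X by rewrite ler_peMr// mulr_ge0// ltW.
have step1 : 3 * cbrt (n%:R * d%:R) * (2 * S + alpha * G ^+ 2) * cbrt V ^+ 2
    <= 3 * (3 * S) * (d%:R * X).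
  have -> : 3 * cbrt (n%:R * d%:R) * (2 * S + alpha * G ^+ 2) * cbrt V ^+ 2
      = 3 * (2 * S + alpha * G ^+ 2) * (cbrt (n%:R * d%:R) * cbrt V ^+ 2) by ring.
  have aG0 : 0 <= alpha * G ^+ 2 by rewrite mulr_ge0 ?sqr_ge0// ltW.
  apply: ler_pM => //; [lra| |lra].
  by apply: mulr_ge0 (sqr_ge0 _); exact: cbrt_ge0.
have step2 : (1 + d%:R) * S <= 2 * (d%:R * S).
  have : S <= d%:R * S by rewrite ler_peMl// ltW.
  lra.
(* 11 = 9 + 2 from the two preceding bounds; with the 14 in S it becomes 154. *)
apply: (@le_trans _ _ (11 * (d%:R * S * X))); first by move: step1 step2 dSX; lra.
pose Y := d%:R ^+ 2 * X * (1 + ln n%:R).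
have Y0 : 0 <= Y.
  apply: mulr_ge0; last exact: addr_ge0.
  by apply: mulr_ge0 (sqr_ge0 _) (le_trans ler01 X1).
have -> : 11 * (d%:R * S * X) = 154 * (W * Y) by rewrite /S /Y; ring.
rewrite (_ : 8 * G ^+ 2 * B ^+ 2 * alpha * d%:R + G ^+ 2 * B ^+ 2 + 1 / alpha
  = W + G ^+ 2 * B ^+ 2); last by rewrite /W addrAC.
have -> : 16 * (1 + ln n%:R) * (140 * d%:R ^+ 2 * (W + G ^+ 2 * B ^+ 2) * X)
  = 2240 * (W * Y) + 2240 * (G ^+ 2 * B ^+ 2 * Y) by rewrite /Y; ring.
have : 0 <= G ^+ 2 * B ^+ 2 * Y by apply: mulr_ge0 => //; apply: mulr_ge0; exact: sqr_ge0.
have : 0 <= W * Y by apply: mulr_ge0 => //; exact: ltW.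
lra.
Qed.
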